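(* The Lagrangian orbit $\mathcal{L}=S^3$ of $\mathrm{U}(2)$ in the flag $\mathbb{F}(1,2)$ is infinitesimally tight. Here $\mathbb{F}(1,2)=\mathrm{Ad}(U)(iH_0)$ with $U=\mathrm{SU}(3)$ and $iH_0=\mathrm{diag}\{i,0,-i\}$, $\mathrm{U}(2)$ is embedded in $\mathrm{SU}(3)$ as the group $U_H$ of block matrices $\begin{pmatrix} z&0\\0&g\end{pmatrix}\in\mathrm{SU}(3)$ with $|z|=1$, $g\in\mathrm{U}(2)$, and $$\mathcal{L}=\left\{\begin{pmatrix}0&\beta\\-\overline{\beta}^{T}&0\end{pmatrix}:\beta=(z_1,z_2)\in\mathbb{C}^2,\ |z_1|^2+|z_2|^2=1\right\}.$$
   Context: $\mathbb{F}(1,2)$ is the maximal flag manifold, realized as the adjoint orbit of $iH_0$ under $U=\mathrm{SU}(3)$ in $\mathfrak{u}=\mathfrak{su}(3)$, with the Kirillov--Kostant--Souriau symplectic form $\omega_x([X,x],[Y,x])=\langle x,[X,Y]\rangle$, where $\langle\cdot,\cdot\rangle$ is the Cartan--Killing form of $\mathfrak{su}(3)$. It is regarded as a homogeneous space of $G=\mathrm{SU}(3)$. The group $U_H\cong\mathrm{U}(2)$ is the centralizer in $\mathrm{SU}(3)$ of $H=i\,\mathrm{diag}\{2,-1,-1\}$, and $\mathcal{L}$ is its Lagrangian orbit in $\mathbb{F}(1,2)$ (diffeomorphic to the sphere $S^3$). Infinitesimally tight: let $M$ be a homogeneous space of a Lie group $G$ with Lie algebra $\mathfrak{g}$ and $G$-invariant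 symplectic form, and let $\widetilde X$ be the fundamental vector field of $X\in\mathfrak{g}$ (here $\widetilde X(x)=[X,x]$). An element $X\in\mathfrak{g}$ is transversal to a submanifold $\mathcal{L}\subset M$ if (1) for any $x\in\mathcal{L}$, $\widetilde X(x)\in T_x\mathcal{L}$ implies $\widetilde X(x)=0$; and (2) the set $f_{\mathcal{L}}(X)=\{x\in\mathcal{L}:0=\widetilde X(x)\in T_x\mathcal{L}\}$ is finite. A Lagrangian submanifold $\mathcal{L}$ is infinitesimally tight if $\#(f_{\mathcal{L}}(X))=\mathrm{SB}(\mathcal{L},\mathbb{Z}_2)$ for every $X\in\mathfrak{g}$ transversal to $\mathcal{L}$, where $\mathrm{SB}(\mathcal{L},\mathbb{Z}_2)$ is the sum of the $\mathbb{Z}_2$ Betti numbers of $\mathcal{L}$. *)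

(* Defs.v *)
From HB Require Import structures.
From mathcomp Require Import all_boot all_order all_algebra.
From mathcomp Require Import complex.
From mathcomp Require Import all_classical all_reals all_analysis.

Set Implicit Arguments.
Unset Strict Implicit.
Unset Printing Implicit Defensive.

Import Order.TTheory GRing.Theory Num.Theory.
Import numFieldNormedType.Exports.

Local Open Scope classical_set_scope.
Local Open Scope card_scope.
Local Open Scope ring_scope.
Local Open Scope sesquilinear_scope.

(** ** Complex matrices as a real normed space *)

(* 'M[R[i]]_(m, n) carries no real vector-space structure in the libraries, so
   linear algebra over R and calculus are done on its image under this
   bijection, Z |-> (Re Z | Im Z). *)
Definition realify (R : realType) m n (Z : 'M[R[i]]_(m, n)) : 'M[R]_(m, n + n) :=
  row_mx (map_mx (@complex.Re R) Z) (map_mx (@complex.Im R) Z).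

Definition unrealify (R : realType) m n (A : 'M[R]_(m, n + n)) : 'M[R[i]]_(m, n) :=
  map2_mx (@Complex R) (lsubmx A) (rsubmx A).

Lemma realifyK (R : realType) m n : cancel (@realify R m n) (@unrealify R m n).
Proof.
move=> Z; rewrite /unrealify /realify row_mxKl row_mxKr.
by apply/matrixP => i j; rewrite !mxE; case: (Z i j).
Qed.

Lemma unrealifyK (R : realType) m n : cancel (@unrealify R m n) (@realify R m n).
Proof.
move=> A; rewrite -[RHS](@hsubmxK _ m n n) /realify.
by congr row_mx; apply/matrixP => i j; rewrite !mxE.
Qed.

(** ** Submanifolds of a normed space *)

(* All iterated directional derivatives exist and are (Frechet) differentiable;
   in finite dimension this is C^oo. *)
Definition smooth (R : realType) (V W : normedModType R) (f : V -> W) : Prop :=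
  forall (vs : seq V) (x : V),
    differentiable (foldr (fun v (g : V -> W) => 'D_v g) f vs) x.

(* Near each of its points, N is the zero set of a submersion. *)
Definition submanifold (R : realType) (V : normedModType R) (N : set V) : Prop :=
  forall x, N x ->
    exists (k : nat) (F : V -> 'rV[R]_k),
      [/\ smooth F,
          (forall w, exists v, 'd F x v = w)
        & \forall y \near x, N y <-> F y = 0].

(* Velocities at x of the curves in N that are differentiable there; for a
   submanifold every such velocity is also that of a smooth curve in N. *)
Definition tangent (R : realType) (V : normedModType R) (N : set V) (x : V) : set V :=
  [set v : V | exists c : R -> V,
     [/\ forall t, N (c t), c 0 = x & is_derive (0 : R) (1 : R) c v]].

(** ** Betti numbers with coefficients in Z/2 *)

Definition simplicial_complex m (K : {set {set 'I_m}}) : Prop :=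
  finset.set0 \notin K /\
  forall s t : {set 'I_m}, s \in K -> t \subset s -> t != finset.set0 -> t \in K.

(* Geometric realization, in barycentric coordinates. *)
Definition polyhedron (R : realType) m (K : {set {set 'I_m}}) : set 'rV[R]_m :=
  [set w : 'rV[R]_m | [/\ forall i, 0 <= w 0 i, \sum_i w 0 i = 1
             & [set i | w 0 i != 0]%SET \in K]].

Arguments polyhedron R {m} K.

Definition simplex m (K : {set {set 'I_m}}) (i : 'I_#|K|) : {set 'I_m} := enum_val i.

(* Chains are row vectors over 'F_2 indexed by all the simplices of K; the rows
   of chains K k span the k-chains, and row vectors u are sent to u *m bd K k by
   the boundary operator on k-chains. *)
Definition chains m (K : {set {set 'I_m}}) (k : nat) : 'M['F_2]_#|K| :=
  \matrix_(i, j) ((i == j) && (#|simplex i| == k.+1))%:R.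

Definition bd m (K : {set {set 'I_m}}) (k : nat) : 'M['F_2]_#|K| :=
  \matrix_(i, j) [&& #|simplex i| == k.+1, #|simplex j| == k
                   & simplex j \subset simplex i]%:R.

Definition betti m (K : {set {set 'I_m}}) (k : nat) : nat :=
  (\rank (chains K k :&: kermx (bd K k))%MS - \rank (bd K k.+1))%N.

Definition homeomorphic (S T : topologicalType) (A : set S) (B : set T) : Prop :=
  exists (f : S -> T) (g : T -> S),
    [/\ {within A, continuous f}, {within B, continuous g},
        {homo f : x / A x >-> B x}, {homo g : y / B y >-> A y}
      & (forall x, A x -> g (f x) = x) /\ (forall y, B y -> f (g y) = y)].

(* s is the sum of the Z/2 Betti numbers of the (triangulable) space N, computed
   in a triangulation of N; it does not depend on the triangulation. *)
Definition is_SB (R : realType) (V : normedModType R) (N : set V) (s : nat) : Prop :=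
  exists (m : nat) (K : {set {set 'I_m}}),
    [/\ simplicial_complex K, homeomorphic (polyhedron R K) N
      & (\sum_(k < m) betti K k)%N = s].

(** ** SU(n), su(n) and the Cartan-Killing form *)

Definition SU (R : realType) n : set 'M[R[i]]_n :=
  [set g : 'M[R[i]]_n | g \is unitarymx /\ \det g = 1].

Definition su (R : realType) n : set 'M[R[i]]_n :=
  [set X : 'M[R[i]]_n | X^t* = - X /\ \tr X = 0].

Definition lie (R : realType) n (X Y : 'M[R[i]]_n) : 'M[R[i]]_n :=
  X *m Y - Y *m X.

Definition su_eqn (R : realType) n (A : 'M[R]_(n, n + n)) :
    'M[R]_(n, n + n) * 'M[R]_(1, 1 + 1) :=
  (realify ((unrealify A)^t* + unrealify A), realify (\tr (unrealify A))%:M).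

Definition su_vspace (R : realType) n : {vspace 'M[R]_(n, n + n)} :=
  lker (linfun (@su_eqn R n)).

Lemma realifyD (R : realType) m n (Y Z : 'M[R[i]]_(m, n)) :
  realify (Y + Z) = realify Y + realify Z.
Proof.
by rewrite /realify add_row_mx; congr row_mx; apply/matrixP => i j;
  rewrite !mxE; case: (Y i j) (Z i j) => ? ? [].
Qed.

Lemma realify_scale (R : realType) m n (a : R) (Z : 'M[R[i]]_(m, n)) :
  realify ((a%:C)%C *: Z) = a *: realify Z.
Proof.
by rewrite /realify scale_row_mx; congr row_mx; apply/matrixP => i j;
  rewrite !mxE; case: (Z i j) => x y /=; rewrite mul0r ?subr0 ?addr0.
Qed.

Lemma realify_inj (R : realType) m n : injective (@realify R m n).
Proof. exact: can_inj (@realifyK R m n). Qed.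

Lemma unrealifyP (R : realType) m n (a : R) (A B : 'M[R]_(m, n + n)) :
  unrealify (a *: A + B) = (a%:C)%C *: unrealify A + unrealify B.
Proof.
by apply: realify_inj; rewrite realifyD realify_scale !unrealifyK.
Qed.

Lemma su_eqn_linear (R : realType) n : linear (@su_eqn R n).
Proof.
move=> a A B; rewrite /su_eqn unrealifyP.
set X := unrealify A; set Y := unrealify B.
have conja : Num.conj (a%:C)%C = (a%:C)%C :> R[i] by rewrite conj_Creal ?complex_real.
have -> : ((a%:C)%C *: X + Y)^t* = (a%:C)%C *: X^t* + Y^t*.
  by apply/matrixP => i j; rewrite !mxE rmorphD rmorphM /= conja.
congr pair; first by rewrite addrACA -scalerDr realifyD realify_scale.
by rewrite raddfD /= linearZ /= raddfD /= -scale_scalar_mx realifyD realify_scale.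
Qed.

HB.instance Definition _ (R : realType) n :=
  GRing.isLinear.Build R _ _ _ (@su_eqn R n) (@su_eqn_linear R n).

Lemma mem_su_vspace (R : realType) n (X : 'M[R[i]]_n) :
  realify X \in su_vspace R n <-> su X.
Proof.
have r0 k l : @realify R k l 0 = 0.
  by rewrite -[0 in LHS](scale0r 0) (realify_scale 0) scale0r.
rewrite memv_ker lfunE /= /su_eqn realifyK /su /=.
split=> [/eqP|[-> ->]]; last by rewrite addNr raddf0 !r0.
move=> [] /eqP; rewrite -(r0 n n) (inj_eq (@realify_inj _ _ _)) addr_eq0 => /eqP ->.
rewrite -(r0 1%N 1%N) => /realify_inj /matrixP /(_ 0 0).
by rewrite !mxE eqxx mulr1n => ->.
Qed.

(* Trace of the restriction of f to an f-invariant subspace U. *)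
Definition trace_on (R : realType) (V : vectType R) (U : {vspace V}) (f : V -> V) : R :=
  \sum_(i < \dim U) coord (vbasis U) i (f (vbasis U)`_i).

(* Cartan-Killing form of the real Lie algebra su(n): trace of ad X \o ad Y. *)
Definition killing (R : realType) n (X Y : 'M[R[i]]_n) : R :=
  trace_on (su_vspace R n)
    (fun A : 'M[R]_(n, n + n) => realify (lie X (lie Y (unrealify A)))).

(** ** Adjoint orbits and infinitesimally tight Lagrangians *)

Definition conj_orbit (R : realType) n (G : set 'M[R[i]]_n) (x : 'M[R[i]]_n) : set 'M[R[i]]_n :=
  [set g *m x *m invmx g | g in G].

Definition mtangent (R : realType) n (L : set 'M[R[i]]_n) (x : 'M[R[i]]_n) : set 'M[R[i]]_n :=
  [set v : 'M[R[i]]_n | tangent [set realify y | y in L] (realify x) (realify v)].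

(* Fundamental vector field on the adjoint orbits. *)
Definition fund (R : realType) n (X x : 'M[R[i]]_n) : 'M[R[i]]_n := lie X x.

(* KKS x X Y is the value of the Kirillov-Kostant-Souriau form omega_x on the
   pair of tangent vectors (fund X x, fund Y x) of the orbit of x. *)
Definition KKS (R : realType) n (x X Y : 'M[R[i]]_n) : R := killing x (lie X Y).

(* L is a submanifold of the orbit M of x0, and at each of its points x, T_x L
   is its own omega_x-orthogonal in T_x M = {fund X x | X in su(n)}. *)
Definition lagrangian (R : realType) n (x0 : 'M[R[i]]_n) (L : set 'M[R[i]]_n) : Prop :=
  [/\ L `<=` conj_orbit (@SU R n) x0,
      submanifold [set realify y | y in L]
    & forall x, L x ->
        mtangent L x =
        [set fund X x | X in [set X | su X /\
           forall Y, su Y -> mtangent L x (fund Y x) -> KKS x X Y = 0]]].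

Definition fL (R : realType) n (L : set 'M[R[i]]_n) (X : 'M[R[i]]_n) : set 'M[R[i]]_n :=
  [set x : 'M[R[i]]_n | [/\ L x, fund X x = 0 & mtangent L x (fund X x)]].

Definition transversal (R : realType) n (L : set 'M[R[i]]_n) (X : 'M[R[i]]_n) : Prop :=
  (forall x, L x -> mtangent L x (fund X x) -> fund X x = 0) /\
  finite_set (fL L X).

Definition infinitesimally_tight (R : realType) n
    (x0 : 'M[R[i]]_n) (L : set 'M[R[i]]_n) : Prop :=
  lagrangian x0 L /\
  exists s : nat, is_SB [set realify y | y in L] s /\
    forall X, su X -> transversal L X -> fL L X #= `I_s.

(** ** The flag F(1,2) and the sphere *)

Definition iH0 (R : realType) : 'M[R[i]]_3 :=
  diag_mx (\row_j [:: 'i; 0; - 'i]`_j).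

Definition Hmx (R : realType) : 'M[R[i]]_3 :=
  'i *: diag_mx (\row_j [:: 2; - 1; - 1]`_j).

Definition U_H (R : realType) : set 'M[R[i]]_3 :=
  [set g : 'M[R[i]]_3 | SU g /\ exists (z : R[i]) (h : 'M[R[i]]_2),
     [/\ `|z| = 1, h \is unitarymx & g = block_mx (z%:M : 'M[R[i]]_1) 0 0 h]].

(* beta = (z_1, z_2) is the row vector b. *)
Definition sphereL (R : realType) : set 'M[R[i]]_3 :=
  [set x : 'M[R[i]]_3 | exists b : 'rV[R[i]]_2,
     `|b 0 0| ^+ 2 + `|b 0 1| ^+ 2 = 1 /\
     x = block_mx (0 : 'M[R[i]]_1) b (- b^t*) (0 : 'M[R[i]]_2)].

Arguments iH0 R : clear implicits.
Arguments Hmx R : clear implicits.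
Arguments U_H R : clear implicits.
Arguments sphereL R : clear implicits.

(* Main.v *)
From HB Require Import structures.
Require Import Defs.
From mathcomp Require Import all_boot all_order all_algebra.
From mathcomp Require Import complex ring lra.
From mathcomp Require Import all_classical all_reals all_analysis.

Set Implicit Arguments.
Unset Strict Implicit.
Unset Printing Implicit Defensive.

Import Order.TTheory GRing.Theory Num.Theory.
Import numFieldNormedType.Exports.

Local Open Scope classical_set_scope.
Local Open Scope ring_scope.
Local Open Scope sesquilinear_scope.

(** Write a block matrix of su(3) as X = diagb k A + off u, where diagb k A
    lies in the Lie algebra of U(2) and off u is the off-diagonal part with
    first row u.  The sphere consists of the off b with |b| = 1, and all brackets
    are explicit: [diagb k A, off b] is again off-diagonal, while [off u, off b]
    is block diagonal and vanishes, for |b| = 1, exactly when u is a real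
    multiple of b (parallel_of_commuting).

    Tangent spaces.  T_(off b) L is the set of the off w with Re <b, w> = 0, and
    the brackets with the isotropy algebra already fill it
    (isotropy_onto_tangent).  This gives the Lagrangian property: on su(n) the
    Killing form is 2n Re tr(X Y) (killingE), so omega pairs [X, x] with [Y, x]
    through Re tr(X [Y, x]).  Block diagonal matrices are trace-orthogonal to
    off-diagonal ones, which makes the tangent space isotropic; conversely, if X
    annihilates the whole tangent space then its off-diagonal part is
    orthogonal to the hyperplane Re <b, w> = 0, hence a real multiple of off b, and [X, x] is
    tangent.

    Tightness.  By the bracket formulas, [X, off b] is tangent exactly when the
    off-diagonal part u of X is a real multiple of b.  If u = 0 this holds on all
    of L, and a transversal X would vanish on the infinite set L; so u is not 0,
    the only candidates are b = u/|u| and b = -u/|u|, and transversality turns both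
    into zeros (fL_off).  Hence there are always two zeros.

    Betti numbers.  The radial projection identifies the boundary of the simplex
    on n + 2 vertices with the n-sphere (homeomorphic_sphere).  Coning off a
    vertex bounds the ranks of the boundary operators from below, and the square
    of the boundary being zero bounds them from above; the resulting
    exact ranks are binomial coefficients, and Pascal's rule leaves one class in
    degree 0 and one in degree n (sum_betti_bdsimplex).  So the sum of the Betti
    numbers is 2 as well.

    Everything but the last part, on U(2) and SU(3), is proved for the unit sphere
    of C^n, or for a linearly embedded sphere of R^n. *)

(** * Mod 2 homology of the boundary of a simplex *)

Lemma rank_diag01 (F : fieldType) N (P : pred 'I_N) :
  \rank (\matrix_(i, j) ((i == j) && P i)%:R : 'M[F]_N) = #|P|.
Proof.
set D := (X in \rank X).
(* The rows of A are the basis vectors selected by P, so that D = A^T A. *)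
pose A : 'M[F]_(#|P|, N) := \matrix_(i, j) (enum_val i == j)%:R.
have AAt : A *m A^T = 1%:M.
  apply/matrixP => i j; rewrite !mxE (bigD1 (enum_val i)) //= !mxE eqxx mul1r.
  rewrite (inj_eq enum_val_inj) eq_sym big1 ?addr0 // => k /negPf nk.
  by rewrite !mxE eq_sym nk mul0r.
have AD : A *m D = A.
  apply/matrixP => i j; rewrite !mxE (bigD1 (enum_val i)) //= !mxE eqxx mul1r.
  rewrite big1 ?addr0 => [|k /negPf nk]; last by rewrite !mxE eq_sym nk mul0r.
  by have := enum_valP i; rewrite unfold_in => ->; rewrite andbT.
have DA : D = A^T *m A.
  apply/matrixP => i j; rewrite !mxE.
  case Pi: (P i); last first.
    rewrite andbF big1 // => k _; rewrite !mxE; case: eqP => [ki|]; last by rewrite mul0r.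
    by have := enum_valP k; rewrite unfold_in ki Pi.
  rewrite andbT (bigD1 (enum_rank_in Pi i)) //= !mxE enum_rankK_in // eqxx mul1r.
  rewrite big1 ?addr0 // => k nk; rewrite !mxE; case: eqP => [ki|]; last by rewrite mul0r.
  by case/eqP: nk; apply: enum_val_inj; rewrite ki enum_rankK_in.
have rA : \rank A = #|P| by apply/eqP/row_freeP; exists A^T.
by apply/eqP; rewrite eqn_leq -{1}rA {1}DA mxrankM_maxr -rA -{1}AD mxrankM_maxr.
Qed.

Definition bdsimplex m : {set {set 'I_m}} :=
  [set s | (s != finset.set0) && (s != [set: 'I_m])]%SET.

Lemma bdsimplex_complex m : simplicial_complex (bdsimplex m).
Proof.
split; first by rewrite inE eqxx.
move=> s t; rewrite !inE => /andP[_ sT] ts ->/=; apply: contraNneq sT => tT.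
by rewrite -finset.subTset -tT.
Qed.

(** Chains are indexed by the ordinals below #|K|; combinatorial arguments need the simplices themselves. *)
Lemma sum_simplex m (K : {set {set 'I_m}}) (V : nmodType) (P : pred {set 'I_m})
    (F : {set 'I_m} -> V) :
  \sum_(i < #|K| | P (simplex i)) F (simplex i) = \sum_(s in K | P s) F s.
Proof.
by rewrite big_mkcond -(big_enum_val (fun s => if P s then F s else 0)) -big_mkcondr.
Qed.

(** The two faces between t and s are t with one of the two points of s :\: t
    added.  Mod 2 this is why the boundary of a boundary vanishes; with t empty
    it says that an edge has two ends. *)
Lemma card_between (T : finType) (K : {set {set T}}) (s t : {set T}) k :
    (forall u : {set T}, u \subset s -> #|u| = k.+1 -> u \in K) ->
    #|s| = k.+2 -> #|t| = k -> t \subset s ->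
  #|[set u : {set T} in K | [&& #|u| == k.+1, t \subset u & u \subset s]]%SET| = 2%N.
Proof.
move=> sK cs ct ts.
have -> : [set u : {set T} in K | [&& #|u| == k.+1, t \subset u & u \subset s]]%SET =
          [set (x |: t)%SET | x in (s :\: t)%SET]%SET.
  apply/setP => u; rewrite inE; apply/idP/imsetP.
    case/and4P => _ /eqP cu tu us.
    have /cards1P[x ux] : #|(u :\: t)%SET| == 1%N by rewrite cardsDS // cu ct subSnn.
    have : x \in (u :\: t)%SET by rewrite ux finset.set11.
    rewrite inE => /andP[xt xu]; exists x; first by rewrite inE xt (fintype.subsetP us).
    by rewrite -ux finset.setUC -{1}(finset.setID u t) (finset.setIidPr tu).
  case=> x; rewrite inE => /andP[xt xs] ->.
  have cu : #|(x |: t)%SET| = k.+1 by rewrite cardsU1 xt ct.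
  have us : (x |: t)%SET \subset s by rewrite finset.subUset finset.sub1set xs ts.
  by rewrite sK // cu eqxx finset.subsetUr us.
rewrite card_in_imset; first by rewrite cardsDS // cs ct subSn ?leqnSn // subSnn.
move=> x y; rewrite !inE => /andP[xt xs] /andP[yt ys] xyt.
have : x \in (x |: t)%SET by rewrite !inE eqxx.
by rewrite xyt !inE (negPf xt) orbF => /eqP.
Qed.

Section BettiSphere.
Variable n : nat.
Let K := bdsimplex n.+2.
Implicit Types (k : nat) (s t u : {set 'I_n.+2}).

Let inK s : (s \in K) = (0 < #|s| < n.+2)%N.
Proof.
rewrite inE card_gt0; congr andb.
by rewrite eqEcard finset.subsetT cardsT card_ord -ltnNge.
Qed.

Let rank_chains k : (k < n.+1)%N -> \rank (chains K k) = 'C(n.+2, k.+1).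
Proof.
move=> kn; rewrite rank_diag01.
have := card_draws 'I_n.+2 k.+1; rewrite card_ord => <-; rewrite -[LHS]sum1_card -[RHS]sum1_card.
rewrite (sum_simplex _ (fun s => #|s| == k.+1) (fun=> 1%N)).
apply: eq_bigl => s; rewrite finset.inE inK andbC.
by case: eqP => // ->; rewrite /= ltnS kn.
Qed.

(** The cone from vertex 0 is a right inverse of the boundary up to simplices
    containing 0: the only face of 0 |: t avoiding 0 is t.  Hence the boundary has
    rank at least the number of k-subsets of the n + 1 other vertices. *)
Let rank_bd_ge k : (0 < k < n.+1)%N -> ('C(n.+1, k) <= \rank (bd K k))%N.
Proof.
move=> /andP[k0 kn].
pose P := [pred s : {set 'I_n.+2} | (#|s| == k) && (ord0 \notin s)].
pose D : 'M['F_2]_#|K| := \matrix_(i, j) ((i == j) && P (simplex i))%:R.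
pose C : 'M['F_2]_#|K| :=
  \matrix_(i, j) (P (simplex i) && (simplex j == ord0 |: simplex i)%SET)%:R.
have CbD : D = C *m bd K k *m D.
  apply/matrixP => i l; rewrite -mulmxA !mxE.
  under eq_bigr => j _ do rewrite mxE.
  case: (boolP (P (simplex i))) => [|_]; last first.
    by rewrite andbF big1 // => j _; rewrite mul0r.
  move=> /[dup] Pi /andP[/= /eqP ci i0]; rewrite andbT.
  have ciU : #|(ord0 |: simplex i)%SET| = k.+1 by rewrite cardsU1 i0 ci.
  have iUK : (ord0 |: simplex i)%SET \in K by rewrite inK ciU.
  pose i' := enum_rank_in iUK (ord0 |: simplex i)%SET.
  have ei' : simplex i' = (ord0 |: simplex i)%SET by rewrite /simplex enum_rankK_in.
  rewrite (bigD1 i') //= ei' eqxx mul1r big1 ?addr0; last first.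
    move=> j ji'; rewrite -ei' (inj_eq enum_val_inj) (negPf ji') mul0r //.
  rewrite !mxE (bigD1 l) //= !mxE eqxx /= ei' big1 ?addr0; last first.
    by move=> j /negPf jl; rewrite !mxE jl mulr0.
  rewrite -natrM mulnb; congr (nat_of_bool _)%:R.
  apply/eqP/idP => [<-|]; first by rewrite ciU ci !eqxx finset.subsetUr i0.
  case/andP=> /and3P[_ /eqP cl lsub] /andP[_ l0].
  apply/esym/enum_val_inj/eqP; rewrite eqEcard ci cl leqnn andbT.
  apply/fintype.subsetP => x xl; move/fintype.subsetP: lsub => /(_ _ xl).
  by rewrite !inE; case: eqP => // x0; move: l0; rewrite -x0 xl.
have -> : 'C(n.+1, k) = \rank D.
  rewrite rank_diag01 -[RHS]sum1_card (sum_simplex _ P (fun=> 1%N)).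
  have c0 : #|[set~ (ord0 : 'I_n.+2)]%SET| = n.+1 by rewrite cardsC1 card_ord.
  rewrite -[n.+1 in LHS]c0 -cards_draws -[LHS]sum1_card; apply: eq_bigl => s.
  rewrite finset.inE inK finset.subsetC finset.sub1set finset.inE andbC /=.
  case: (eqVneq #|s| k) => [->|]; last by rewrite !andbF.
  by rewrite k0 (leq_trans kn) // ?andbT.
by rewrite CbD (leq_trans (mxrankM_maxl _ _)) ?mxrankM_maxr.
Qed.

Let chains_mul k p (B : 'M['F_2]_(#|K|, p)) :
  chains K k *m B = \matrix_(i, j) (if #|simplex i| == k.+1 then B i j else 0).
Proof.
apply/matrixP => i j; rewrite !mxE (bigD1 i) //= !mxE eqxx /= big1 ?addr0; last first.
  by move=> l li; rewrite !mxE eq_sym (negPf li) mul0r.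
by rewrite mulr_natl mulrb.
Qed.

Let bd_chains k : bd K k.+1 *m chains K k = bd K k.+1.
Proof.
apply/matrixP => i j; rewrite !mxE (bigD1 j) //= !mxE eqxx /= big1 ?addr0; last first.
  by move=> l li; rewrite !mxE (negPf li) mulr0.
by rewrite -natrM mulnb; case: (#|simplex j| == k.+1); rewrite ?andbT ?andbF.
Qed.

Let chains_bd k : chains K k *m bd K k = bd K k.
Proof.
by rewrite chains_mul; apply/matrixP => i j; rewrite !mxE; case: eqP.
Qed.

Let faces_between k s t :
    s \in K -> #|s| = k.+2 -> #|t| = k -> t \subset s ->
  \sum_(j < #|K|) [&& #|simplex j| == k.+1, t \subset simplex j
                    & simplex j \subset s]%:R = 0 :> 'F_2.
Proof.
rewrite inK => /andP[_ sK] cs ct ts; rewrite -natr_sum -big_mkcond /=.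
rewrite (sum_simplex _ (fun u => [&& #|u| == k.+1, t \subset u & u \subset s]) (fun=> 1%N)).
rewrite sum1dep_card (card_between _ cs ct ts); first by apply/val_inj.
by move=> u _ cu; rewrite inK cu /= (ltn_trans _ sK) // cs.
Qed.

Let bd_bd k : bd K k.+1 *m bd K k = 0.
Proof.
apply/matrixP => i l; rewrite !mxE.
under eq_bigr => j _ do rewrite !mxE -natrM mulnb.
have [/and3P[/eqP ci /eqP cl li]|] :=
    boolP [&& #|simplex i| == k.+2, #|simplex l| == k & simplex l \subset simplex i].
  rewrite -[RHS](faces_between (enum_valP i) ci cl li).
  apply: eq_bigr => j _; rewrite ci cl !eqxx /=; congr (nat_of_bool _)%:R.
  by case: eqP => //= _; rewrite andbC.
move=> nil; apply: big1 => j _; rewrite (_ : _ && _ = false) //.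
apply: contraNF nil => /andP[/and3P[-> _ ji] /and3P[_ -> lj]].
exact: fintype.subset_trans ji.
Qed.

(** The rows of the boundary operator are k-chains killed by B; compare dimensions. *)
Let rank_bd_add p k (B : 'M['F_2]_(#|K|, p)) : bd K k.+1 *m B = 0 ->
  (\rank (bd K k.+1) + \rank (chains K k *m B) <= \rank (chains K k))%N.
Proof.
move=> bB; rewrite -(mxrank_mul_ker (chains K k) B) addnC leq_add2l.
by apply: mxrankS; rewrite sub_capmx sub_kermx bB eqxx andbT -bd_chains submxMl.
Qed.

(** The upper bound goes by induction on k, each rank bounding the next one.  The
    first step uses the augmentation, the column of ones, whose kernel contains
    the boundaries of edges. *)
Let rank_bd k : (0 < k < n.+1)%N -> \rank (bd K k) = 'C(n.+1, k).
Proof.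
move=> kn; apply/eqP; rewrite eqn_leq rank_bd_ge // andbT.
case: k kn => // k; elim: k => [|k IH] kn.
  pose B : 'M['F_2]_(#|K|, 1) := const_mx 1.
  have bB : bd K 1 *m B = 0.
    apply/matrixP => i l; rewrite !mxE.
    under eq_bigr => j _ do rewrite !mxE mulr1.
    have [ci|ci] := boolP (#|simplex i| == 2%N); last by rewrite big1.
    rewrite -[RHS](faces_between (enum_valP i) (eqP ci) (cards0 _)) ?finset.sub0set //.
    by apply: eq_bigr => j _; rewrite finset.sub0set.
  have := rank_bd_add bB; rewrite rank_chains // bin1.
  suff -> : \rank (chains K 0 *m B) = 1%N by rewrite addn1 bin1 ltnS.
  apply/eqP; rewrite eqn_leq rank_leq_col lt0n mxrank_eq0.
  have xK : [set ord0]%SET \in K by rewrite inK cards1.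
  apply/eqP => /matrixP/(_ (enum_rank_in xK [set ord0]%SET) ord0).
  by rewrite chains_mul !mxE /simplex enum_rankK_in // cards1.
have := rank_bd_add (bd_bd k.+1); rewrite chains_bd.
have kn' : (0 < k.+1 < n.+1)%N by move/andP: kn => [_ /ltnW].
rewrite rank_chains; last by case/andP: kn'.
have -> : \rank (bd K k.+1) = 'C(n.+1, k.+1).
  by apply/eqP; rewrite eqn_leq rank_bd_ge // andbT IH //; case/andP: kn'.
by rewrite [X in (_ <= X)%N]binS leq_add2r.
Qed.

(** By Pascal's rule the cycles and the boundaries have the same dimension, except
    in degree 0, where the augmentation is missing, and in degree n, where there
    are no boundaries. *)
Lemma sum_betti_bdsimplex : (\sum_(k < n.+2) betti K k)%N = 2%N.
Proof.
have r0 : \rank (bd K 0) = 0%N.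
  apply/eqP; rewrite mxrank_eq0; apply/eqP/matrixP => i j; rewrite !mxE.
  case: eqP => //= _; case: eqP => //= c0.
  by have := enum_valP j; rewrite inK -/(simplex j) c0.
have rtop k : (n < k)%N -> \rank (bd K k) = 0%N.
  move=> nk; apply/eqP; rewrite mxrank_eq0; apply/eqP/matrixP => i j; rewrite !mxE.
  case: eqP => //= ci.
  by have := enum_valP i; rewrite inK -/(simplex i) ci => /andP[_]; rewrite !ltnS leqNgt nk.
have cyc k : \rank (chains K k :&: kermx (bd K k))%MS = (\rank (chains K k) - \rank (bd K k))%N.
  by rewrite -(mxrank_mul_ker (chains K k) (bd K k)) chains_bd addKn.
under eq_bigr => k _ do rewrite /betti cyc.
have ctop : \rank (chains K n.+1) = 0%N.
  apply/eqP; rewrite mxrank_eq0; apply/eqP/matrixP => i j; rewrite !mxE.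
  case: eqP => //= _; case: eqP => //= ci.
  by have := enum_valP i; rewrite inK -/(simplex i) ci ltnn andbF.
rewrite big_ord_recr /= ctop !sub0n addn0.
(* For n = 0 both classes live in degree 0. *)
have term (k : 'I_n.+1) : (\rank (chains K k) - \rank (bd K k) - \rank (bd K k.+1))%N =
    ((k == ord0) + (k == ord_max))%N.
  rewrite rank_chains // binS -!val_eqE /=.
  have [k0|k0] := posnP k.
    rewrite k0 r0 bin0 bin1 subn0 [_ == n]eq_sym.
    have [n0|n0] := posnP n; first by rewrite rtop n0.
    by rewrite rank_bd ?bin1 ?addKn ?(gtn_eqF n0) ?n0.
  rewrite rank_bd ?k0 ?ltn_ord // addnK /=.
  have [kn|kn] := eqVneq (k : nat) n; first by rewrite rtop kn // subn0 binn.
  have := ltn_ord k; rewrite ltnS leq_eqVlt (negPf kn) /= => ltkn.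
  by rewrite rank_bd ?subnn.
rewrite (eq_bigr _ (fun (k : 'I_n.+1) _ => term k)) big_split /=.
have sum_eq (a : 'I_n.+1) : (\sum_(k < n.+1) (k == a))%N = 1%N.
  by rewrite (bigD1 a) //= eqxx big1 ?addn0 // => j /negPf ->.
by rewrite !sum_eq.
Qed.
End BettiSphere.

(** * Smooth functions on matrix spaces *)

Lemma continuous_linear_mx (R : realType) m n (W : normedModType R)
  (f : {linear 'M[R]_(m, n) -> W}) : continuous f.
Proof.
have -> : f = (fun A => \sum_i \sum_j A i j *: f (delta_mx i j)) :> (_ -> _).
  apply/funext => A; rewrite {1}(matrix_sum_delta A) linear_sum.
  by apply: eq_bigr => i _; rewrite linear_sum; apply: eq_bigr => j _; rewrite linearZ.
apply: continuous_big => [|i _]; first exact: add_continuous.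
apply: continuous_big => [|j _]; first exact: add_continuous.
move=> A; apply: (@cvgZr_tmp R W _ (nbhs A)); exact: coord_continuous.
Qed.

Lemma is_diff_sum (R : realType) (V W : normedModType R) (I : Type) (s : seq I)
    (f df : I -> V -> W) x :
  (forall i, is_diff x (f i) (df i)) ->
  is_diff x (fun y => \sum_(i <- s) f i y) (fun y => \sum_(i <- s) df i y).
Proof.
move=> dfi; elim: s => [|i s IH].
  rewrite (_ : (fun=> _) = cst 0); last by apply/funext => y; rewrite big_nil.
  rewrite (_ : (fun y => _) = 0); last by apply/funext => y; rewrite big_nil.
  exact: is_diff_cst.
have -> : (fun y => \sum_(i <- i :: s) f i y) = f i + (fun y => \sum_(i <- s) f i y).
  by apply/funext => y; rewrite big_cons.
have -> : (fun y => \sum_(i <- i :: s) df i y) = df i + (fun y => \sum_(i <- s) df i y).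
  by apply/funext => y; rewrite big_cons.
exact: is_diffD.
Qed.

Lemma is_diff_linear_mx (R : realType) m n (W : normedModType R)
  (f : {linear 'M[R]_(m, n) -> W}) x : is_diff x f f.
Proof.
have cf := @continuous_linear_mx _ _ _ _ f.
by apply: DiffDef; [exact: linear_differentiable|exact: diff_lin].
Qed.

(** The innermost derivative of the iterated one is taken along the last vector of the list. *)
Lemma smooth_derive (R : realType) (V W : normedModType R) (f : V -> W) :
  (forall x, differentiable f x) -> (forall v, smooth ('D_v f)) -> smooth f.
Proof.
move=> df sDf vs x; case: (lastP vs) => [|ws v]; first exact: df.
by rewrite foldr_rcons; exact: sDf.
Qed.

Lemma smooth_cst (R : realType) (V W : normedModType R) (a : W) :
  smooth (cst a : V -> W).
Proof.
move=> vs; have [b ->] : exists b, foldr (fun v (g : V -> W) => 'D_v g) (cst a) vs = cst b.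
  elim: vs => [|v vs [b /= ->]]; first by exists a.
  by exists 0; apply/funext => x; rewrite deriveE // diff_cst.
by move=> x; exact: differentiable_cst.
Qed.

Lemma smooth_affine (R : realType) m n (W : normedModType R)
    (f : {linear 'M[R]_(m, n) -> W}) (a : W) :
  smooth (fun x => f x + a).
Proof.
have df x : is_diff x (fun x => f x + a) f.
  have := is_diffD (is_diff_linear_mx f x) (is_diff_cst a x).
  by rewrite addr0.
apply: smooth_derive => [x|v]; first exact: ex_diff.
have -> : 'D_v (fun x => f x + a) = cst (f v); last exact: smooth_cst.
by apply/funext => x; rewrite deriveE ?diff_val //; exact: ex_diff.
Qed.

(** * Linearly embedded spheres *)

Definition dotv (R : realType) n (r s : 'rV[R]_n) : R := \sum_i r 0 i * s 0 i.

Definition usphere (R : realType) n : set 'rV[R]_n := [set r | dotv r r = 1].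
Arguments usphere R n : clear implicits.

Section DotTheory.
Variables (R : realType) (n : nat).
Implicit Types r s t : 'rV[R]_n.

Lemma dotvC r s : dotv r s = dotv s r.
Proof. by apply: eq_bigr => i _; rewrite mulrC. Qed.

Lemma dotvDl r s t : dotv (r + s) t = dotv r t + dotv s t.
Proof. by rewrite /dotv -big_split; apply: eq_bigr => i _; rewrite mxE mulrDl. Qed.

Lemma dotvZl a r s : dotv (a *: r) s = a * dotv r s.
Proof. by rewrite /dotv mulr_sumr; apply: eq_bigr => i _; rewrite mxE mulrA. Qed.

Lemma dotvDr r s t : dotv r (s + t) = dotv r s + dotv r t.
Proof. by rewrite dotvC dotvDl !(dotvC _ r). Qed.

Lemma dotvZr a r s : dotv r (a *: s) = a * dotv r s.
Proof. by rewrite dotvC dotvZl dotvC. Qed.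

Lemma dotv_ge0 r : 0 <= dotv r r.
Proof. by apply: sumr_ge0 => i _; rewrite -expr2 sqr_ge0. Qed.

Lemma dotv_eq0 r : (dotv r r == 0) = (r == 0).
Proof.
apply/eqP/eqP => [/eqP|->]; last by rewrite /dotv big1 // => i _; rewrite mxE mul0r.
rewrite psumr_eq0 => [/allP r0|i _]; last by rewrite -expr2 sqr_ge0.
apply/rowP => i; rewrite mxE; apply/eqP.
by have := r0 i (mem_index_enum _); rewrite /= mulf_eq0 orbb.
Qed.

Lemma usphere_neq0 r : usphere R n r -> r != 0.
Proof. by move=> r1; rewrite -dotv_eq0 r1 oner_eq0. Qed.
End DotTheory.

Lemma is_derive_scalel (R : realType) (W : normedModType R) (f : R -> R) (w : W)
    (t df : R) :
  is_derive t 1 f df -> is_derive t 1 (fun u => f u *: w) (df *: w).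
Proof.
move=> dft.
have fd : differentiable f t by apply/derivable1_diffP; exact: ex_derive.
have dg := is_diff_comp (differentiableP fd) (is_diff_scalel (f t) w).
have gd : differentiable (fun u => f u *: w) t by exact: (@ex_diff _ _ _ _ _ _ _ dg).
apply: DeriveDef; first exact/derivable1_diffP.
by rewrite deriveE // (@diff_val _ _ _ _ _ _ _ dg) /= -deriveE // derive_val.
Qed.

(** A unit sphere is placed in a space of matrices by a linear map e with a linear
    retraction q; everything about it is deduced from these two maps. *)
Section EmbeddedSphere.
Variables (R : realType) (n m p : nat).
Variables (e : {linear 'rV[R]_n -> 'M[R]_(m, p)}) (q : {linear 'M[R]_(m, p) -> 'rV[R]_n}).
Hypothesis eK : cancel e q.

(** The image of v |-> v - e (q v), a complement of the image of e.  Coordinates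
    in it make the linear part of the equations of the sphere submersive. *)
Definition normal_space : {vspace 'M[R]_(m, p)} := lker (linfun (e \o q)).
Local Notation k := (\dim normal_space).

Definition normal_coord (v : 'M[R]_(m, p)) : 'rV[R]_(k + 1) :=
  row_mx (\row_i coord (vbasis normal_space) i (v - e (q v))) 0.

Lemma normal_coord_linear : linear normal_coord.
Proof.
move=> a u v; rewrite /normal_coord scale_row_mx add_row_mx !scaler0 !addr0; congr row_mx.
apply/rowP => i; rewrite !mxE -linearP; congr (coord _ _ _).
by rewrite !linearP /= addrACA -scalerDr.
Qed.
HB.instance Definition _ := GRing.isLinear.Build R _ _ _ normal_coord normal_coord_linear.

Local Notation last := (row_mx 0 1 : 'rV[R]_(k + 1)).

(** The differential at a of the quadratic equation. *)
Definition radial_coord (a v : 'M[R]_(m, p)) : 'rV[R]_(k + 1) :=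
  (2 * dotv (q a) (q v)) *: last.

Lemma radial_coord_linear a : linear (radial_coord a).
Proof.
move=> c u v; rewrite /radial_coord linearP dotvDr dotvZr scalerA -scalerDl.
by congr (_ *: _); rewrite mulrDr mulrCA.
Qed.
HB.instance Definition _ a :=
  GRing.isLinear.Build R _ _ _ (radial_coord a) (radial_coord_linear a).

Definition sphere_eqn (v : 'M[R]_(m, p)) : 'rV[R]_(k + 1) :=
  normal_coord v + (dotv (q v) (q v) - 1) *: last.

Lemma sphere_eqn_diff x :
  is_diff x sphere_eqn (fun v => normal_coord v + radial_coord x v).
Proof.
pose c i : 'M[R]_(m, p) -> R := (fun r : 'rV[R]_n => r 0 i) \o q.
have dc i : is_diff x (c i) (c i).
  have c_lin : linear (c i) by move=> a u v; rewrite /c /= linearP !mxE.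
  pose cL := GRing.isLinear.Build R _ _ _ (c i) c_lin.
  pose C : {linear 'M[R]_(m, p) -> R} := HB.pack (c i) cL.
  exact: (is_diff_linear_mx C x).
have dq : is_diff x (fun v => dotv (q v) (q v)) (fun v => 2 * dotv (q x) (q v)).
  have := is_diff_sum (index_enum 'I_n) (fun i => is_diffM (dc i) (dc i)).
  move=> /is_diff_eq; apply; apply/funext => v; rewrite mulr_sumr.
  by apply: eq_bigr => i _; rewrite -[LHS]/(c i x * c i v + c i x * c i v) -mulr2n mulr_natl.
have ds := is_diff_comp dq (is_diffB (is_diff_id _) (is_diff_cst (1 : R) _)).
have dl := is_diff_comp ds (is_diff_scalel _ (last : 'rV[R]_(k + 1))).
have := is_diffD (is_diff_linear_mx normal_coord x) dl.
by move=> /is_diff_eq; apply; apply/funext => v; rewrite /= subr0.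
Qed.

(** Directional derivatives of the quadratic equations are affine. *)
Lemma smooth_sphere_eqn : smooth sphere_eqn.
Proof.
apply: smooth_derive => [x|v]; first exact: (@ex_diff _ _ _ _ _ _ _ (sphere_eqn_diff x)).
have -> : 'D_v sphere_eqn = (fun x => radial_coord v x + normal_coord v).
  apply/funext => x; rewrite deriveE; last exact: (@ex_diff _ _ _ _ _ _ _ (sphere_eqn_diff x)).
  by rewrite (@diff_val _ _ _ _ _ _ _ (sphere_eqn_diff x)) addrC /radial_coord dotvC.
exact: smooth_affine.
Qed.

Lemma normal_radial_eq0 v a : normal_coord v + a *: last = 0 -> v = e (q v) /\ a = 0.
Proof.
rewrite /normal_coord scale_row_mx add_row_mx scaler0 addr0 add0r -[RHS]row_mx0.
move=> /eq_row_mx[c0 a0]; split; last first.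
  by move/matrixP/(_ 0 0): a0; rewrite !mxE mulr1.
apply/eqP; rewrite -subr_eq0; apply/eqP.
have vU : v - e (q v) \in normal_space by rewrite memv_ker lfunE /= linearB /= eK subrr linear0.
rewrite (coord_vbasis vU) big1 // => i _.
by move/rowP/(_ i): c0; rewrite !mxE => ->; rewrite scale0r.
Qed.

Lemma sphere_eqnP v : [set e r | r in usphere R n] v <-> sphere_eqn v = 0.
Proof.
split=> [[r r1 <-]|/normal_radial_eq0[ve v1]].
  rewrite /sphere_eqn eK r1 subrr scale0r addr0 /normal_coord eK subrr -row_mx0.
  by congr row_mx; apply/rowP => i; rewrite !mxE linear0.
by exists (q v) => //; apply/eqP; rewrite -subr_eq0 v1.
Qed.

Lemma submanifold_sphere : submanifold [set e r | r in usphere R n].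
Proof.
move=> _ [r r1 <-]; exists (k + 1)%N, sphere_eqn; split.
- exact: smooth_sphere_eqn.
- move=> w.
  (* Preimage of w: the normal part is prescribed freely, and the last coordinate
     is reached along the radius r. *)
  pose u := \sum_i lsubmx w 0 i *: (vbasis normal_space)`_i.
  have uU : u \in normal_space.
    by apply: memv_suml => i _; rewrite memvZ // vbasis_mem // mem_nth // size_tuple.
  have qu : q u = 0.
    by move: uU; rewrite memv_ker lfunE /= => /eqP eu; rewrite -(eK (q u)) eu linear0.
  exists (u + e ((rsubmx w 0 0 / 2) *: r)).
  rewrite (@diff_val _ _ _ _ _ _ _ (sphere_eqn_diff _)) /normal_coord /radial_coord.
  rewrite [q (_ + _)]linearD /= !eK qu !add0r dotvZr r1 mulr1 mulrCA divff ?pnatr_eq0 // mulr1.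
  rewrite addrK scale_row_mx add_row_mx scaler0 add0r addr0 -[RHS]hsubmxK; congr row_mx.
    apply/rowP => i; rewrite !mxE coord_sum_free ?mxE //.
    exact: basis_free (vbasisP _).
  by rewrite [RHS]mx11_scalar -scalemx1.
- by near=> y; apply: sphere_eqnP.
Unshelve. all: by end_near. Qed.

(** Velocities of curves in the sphere are killed by the differential of the
    equations.  Conversely, the stereographic parametrization of the great circle
    through r in the direction s has velocity s and needs no trigonometry. *)
Lemma tangent_sphere r : usphere R n r ->
  tangent [set e r | r in usphere R n] (e r) = [set e s | s in [set s | dotv r s = 0]].
Proof.
move=> r1; apply/seteqP; split=> [v [c [Nc c0 dc]]|_ [s rs <-]].
  have dc0 : differentiable c 0 by apply/derivable1_diffP; exact: ex_derive.
  have dF : differentiable sphere_eqn (c 0).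
    exact: (@ex_diff _ _ _ _ _ _ _ (sphere_eqn_diff _)).
  have Fc : sphere_eqn \o c = cst 0 by apply/funext => t; apply/sphere_eqnP.
  have := diff_comp dc0 dF; rewrite Fc diff_cst => /(congr1 (@^~ 1)) /=.
  rewrite (@diff_val _ _ _ _ _ _ _ (sphere_eqn_diff _)) c0.
  rewrite -(deriveE _ dc0) derive_val => /esym/normal_radial_eq0[ve].
  rewrite eK => /eqP; rewrite mulf_eq0 pnatr_eq0 /= => /eqP rv.
  by exists (q v).
(* The curve is ((1 - a t^2) r + t s) / (1 + a t^2), with first coefficient 2 w - 1. *)
pose a := dotv s s / 4.
pose w t : R := (1 + a * t ^+ 2)^-1.
have w0 t : 1 + a * t ^+ 2 != 0.
  by rewrite gt_eqF // ltr_wpDr // mulr_ge0 ?sqr_ge0 // divr_ge0 ?dotv_ge0.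
pose A t := 2 * w t - 1; pose B t := t * w t.
exists (fun t => A t *: e r + B t *: e s); split=> [t||].
- exists (A t *: r + B t *: s); last by rewrite linearD !linearZ.
  rewrite /usphere /= !(dotvDl, dotvDr, dotvZl, dotvZr) (dotvC s r) rs r1.
  have -> : dotv s s = 4 * a by rewrite mulrC divfK ?pnatr_eq0.
  rewrite /A /B /w; field; exact: w0.
- by rewrite /A /B /w expr0n mulr0 addr0 invr1 mul0r scale0r addr0 mulr1 -addrA subrr addr0 scale1r.
have dw : is_derive (0 : R) 1 w 0.
  have du : is_derive (0 : R) 1 (fun t => 1 + a * t ^+ 2) 0.
    have := is_deriveD (is_derive_cst (1 : R) (0 : R) 1)
      (is_deriveZ a (is_deriveX 2 (is_derive_id (0 : R) 1))).
    by move=> /is_derive_eq; apply; rewrite expr1 mulr0 scale0r scaler0 addr0.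
  by have := @is_deriveV R (fun t => 1 + a * t ^+ 2) 0 0 1 (w0 0) du; rewrite scaler0.
have dA : is_derive (0 : R) 1 A 0.
  have := is_deriveB (is_deriveZ 2 dw) (is_derive_cst (1 : R) (0 : R) 1).
  by move=> /is_derive_eq; apply; rewrite scaler0 subr0.
have dB : is_derive (0 : R) 1 B 1.
  have := is_deriveM (is_derive_id (0 : R) 1) dw.
  move=> /is_derive_eq; apply.
  by rewrite scaler0 add0r /w expr0n mulr0 addr0 invr1 scale1r.
have := is_deriveD (is_derive_scalel (e r) dA) (is_derive_scalel (e s) dB).
by rewrite scale0r add0r scale1r.
Qed.
End EmbeddedSphere.

(** * The sphere as the boundary of a simplex *)

(** Both maps are written modulo translation along (1, ..., 1) and positive
    scaling.  Subtracting the coordinate 0 identifies R^(1 + n) modulo constants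
    with R^n; the representative with minimum 0 lies on the boundary of the
    positive orthant.  Normalizing by the Euclidean norm on one side and by the sum
    of the coordinates on the other gives mutually inverse maps. *)
Section RadialProjection.
Variables (R : realType) (n : nat).
Implicit Types (b : 'rV[R]_n) (w : 'rV[R]_(1 + n)).

Definition pad b : 'rV[R]_(1 + n) := row_mx 0 b.

Definition unpad w : 'rV[R]_n := rsubmx w - const_mx (w 0 0).

(** The initial value 0 is harmless because pad b has the coordinate 0. *)
Definition padmin b : R := \big[Num.min/0]_i pad b 0 i.

Lemma padE0 b : pad b 0 0 = 0.
Proof.
rewrite mxE; case: split_ordP => j; first by rewrite mxE.
by move=> /(congr1 val).
Qed.

Lemma pad_linear : linear pad.
Proof. by move=> a u v; rewrite /pad scale_row_mx add_row_mx scaler0 addr0. Qed.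

Lemma unpad_linear : linear unpad.
Proof.
by move=> a u v; apply/rowP => i; rewrite !mxE mulrBr opprD addrACA.
Qed.

Lemma unpadK w : pad (unpad w) = w - const_mx (w 0 0).
Proof.
apply/rowP => i; rewrite !mxE; case: split_ordP => j ->; rewrite !mxE //.
by rewrite ord1 (_ : lshift n 0 = 0) ?subrr //; apply/val_inj.
Qed.

Lemma padmin_le b i : padmin b <= pad b 0 i.
Proof. exact: bigmin_le. Qed.

Lemma padmin_attained b : exists i, padmin b = pad b 0 i.
Proof.
rewrite /padmin; elim/big_ind: _ => [|x y [i ->] [j ->]|i _]; last by exists i.
  by exists 0; rewrite padE0.
by rewrite minElt; case: ifP => _; [exists i|exists j].
Qed.

Lemma padmin_unique b c i : (forall j, c <= pad b 0 j) -> c = pad b 0 i -> padmin b = c.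
Proof.
move=> cle ci; apply: le_anti; rewrite {1}ci padmin_le /=.
by have [j ->] := padmin_attained b.
Qed.

Definition lift_min b : 'rV[R]_(1 + n) := pad b - const_mx (padmin b).

Lemma lift_minE b i : lift_min b 0 i = pad b 0 i - padmin b.
Proof. by rewrite /lift_min mxE; congr (_ + _); rewrite !mxE. Qed.

Lemma lift_min_ge0 b i : 0 <= lift_min b 0 i.
Proof. by rewrite lift_minE subr_ge0 padmin_le. Qed.

Lemma unpad_lift_min b : unpad (lift_min b) = b.
Proof.
apply/rowP => i; rewrite mxE [X in X + _]mxE [X in _ + X]mxE [X in _ - X]mxE.
by rewrite !lift_minE padE0 sub0r opprK addrNK /pad row_mxEr.
Qed.

Lemma sum_lift_min_gt0 b : b != 0 -> 0 < \sum_i lift_min b 0 i.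
Proof.
move=> b0; rewrite lt_def sumr_ge0 ?andbT => [|i _]; last exact: lift_min_ge0.
apply: contraNneq b0 => /eqP.
rewrite psumr_eq0 => [/allP s0|i _]; last exact: lift_min_ge0.
rewrite -(unpad_lift_min b) (_ : lift_min b = 0).
  by apply/eqP/rowP => i; rewrite !mxE subrr.
by apply/rowP => i; rewrite [RHS]mxE; apply/eqP/s0; rewrite mem_index_enum.
Qed.

Lemma continuous_linear_fun m p k l (f : 'M[R]_(m, p) -> 'M[R]_(k, l)) :
  linear f -> continuous f.
Proof.
move=> f_linear.
pose fL := GRing.isLinear.Build R _ _ _ f f_linear.
pose F : {linear 'M[R]_(m, p) -> 'M[R]_(k, l)} := HB.pack f fL.
exact: (@continuous_linear_mx _ _ _ _ F).
Qed.

Lemma continuous_padmin : continuous padmin.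
Proof.
apply: continuous_big => [|i _]; first exact: min_continuous.
move=> b; apply: (@continuous_comp _ _ _ pad (fun u : 'rV[R]_(1 + n) => u 0 i)).
  by apply: continuous_linear_fun; exact: pad_linear.
exact: coord_continuous.
Qed.

Lemma continuous_lift_min : continuous lift_min.
Proof.
move=> b.
have -> : lift_min = fun b => pad b - padmin b *: const_mx 1.
  by apply/funext => u; rewrite scalemx_const mulr1.
apply: (@cvgB _ _ _ (nbhs b)).
  by apply: continuous_linear_fun; exact: pad_linear.
by apply: (@cvgZr_tmp _ _ _ (nbhs b)); exact: continuous_padmin.
Qed.

Lemma continuous_dotv : continuous (fun r : 'rV[R]_n => dotv r r).
Proof.
apply: continuous_big => [|i _]; first exact: add_continuous.
by move=> r; apply: (@cvgM _ _ (nbhs r)); exact: coord_continuous.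
Qed.

Definition to_sphere w : 'rV[R]_n := (Num.sqrt (dotv (unpad w) (unpad w)))^-1 *: unpad w.

Definition to_simplex b : 'rV[R]_(1 + n) := (\sum_i lift_min b 0 i)^-1 *: lift_min b.

Lemma polyhedron_bdsimplexP w : polyhedron R (bdsimplex (1 + n)) w <->
  [/\ forall i, 0 <= w 0 i, \sum_i w 0 i = 1 & exists i, w 0 i = 0].
Proof.
rewrite /polyhedron /= /bdsimplex; split=> -[w0 w1].
  rewrite finset.inE => /andP[_ /negP nT]; split=> //; apply: contrapT => nex.
  apply: nT; apply/eqP/setP => i; rewrite !inE; apply/negP => /eqP wi0.
  by apply: nex; exists i.
move=> [i wi]; split=> //; rewrite finset.inE; apply/andP; split.
  apply/eqP => /setP s0; move: w1; rewrite big1 => [/eqP|j _]; first by rewrite eq_sym oner_eq0.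
  by have := s0 j; rewrite !inE => /negbFE/eqP.
by apply/eqP => /setP/(_ i); rewrite !inE wi eqxx.
Qed.

Lemma dotv_unpad_gt0 w : polyhedron R (bdsimplex (1 + n)) w -> 0 < dotv (unpad w) (unpad w).
Proof.
move=> /polyhedron_bdsimplexP[w0 w1 [i wi]]; rewrite lt_def dotv_ge0 andbT dotv_eq0.
apply/eqP => u0; have /eqP := unpadK w; rewrite u0 eq_sym subr_eq.
have -> : pad 0 = 0 by rewrite /pad row_mx0.
rewrite add0r => /eqP wc; move: w1; rewrite big1 => [/eqP|j _]; first by rewrite eq_sym oner_eq0.
by move: wi; rewrite wc !mxE.
Qed.

(** If rho is the norm of unpad w, then w / rho has minimum 0 and differs from the
    padded point by a constant, so that lift_min recovers it. *)
Lemma to_simplex_sphere w : polyhedron R (bdsimplex (1 + n)) w -> to_simplex (to_sphere w) = w.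
Proof.
move=> Pw; have d0 := dotv_unpad_gt0 Pw; have /polyhedron_bdsimplexP[w0 w1 [i wi]] := Pw.
rewrite /to_simplex /to_sphere; set rho := Num.sqrt _.
have r0 : 0 < rho by rewrite sqrtr_gt0.
have padE : pad (rho^-1 *: unpad w) = rho^-1 *: (w - const_mx (w 0 0)).
  by rewrite -unpadK /pad scale_row_mx scaler0.
have min : padmin (rho^-1 *: unpad w) = - rho^-1 * w 0 0.
  apply: (@padmin_unique _ _ i) => [j|]; rewrite padE !mxE ?wi ?sub0r ?mulrN ?mulNr //.
  by rewrite mulrBr lerDr mulr_ge0 // invr_ge0 ltW.
have -> : lift_min (rho^-1 *: unpad w) = rho^-1 *: w.
  apply/rowP => j; rewrite /lift_min padE min !mxE; ring.
rewrite scalerA; under eq_bigr => j _ do rewrite mxE.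
by rewrite -mulr_sumr w1 mulr1 invrK divff ?scale1r // gt_eqF.
Qed.

Lemma to_sphere_simplex b : usphere R n b -> to_sphere (to_simplex b) = b.
Proof.
move=> b1; have b0 := usphere_neq0 b1.
have S0 := sum_lift_min_gt0 b0; rewrite /to_sphere /to_simplex; set S := \sum_i _ in S0 *.
have -> : unpad (S^-1 *: lift_min b) = S^-1 *: b.
  rewrite -{2}(unpad_lift_min b); apply/rowP => i; rewrite !mxE; ring.
rewrite dotvZl dotvZr b1 mulr1 -expr2 sqrtr_sqr ger0_norm ?invr_ge0 ?(ltW S0) // invrK.
by rewrite scalerA divff ?scale1r // gt_eqF.
Qed.

Lemma to_sphere_usphere w : polyhedron R (bdsimplex (1 + n)) w -> usphere R n (to_sphere w).
Proof.
move=> /dotv_unpad_gt0 d0; rewrite /usphere /= /to_sphere dotvZl dotvZr mulrA -expr2 exprVn.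
by rewrite sqr_sqrtr ?(ltW d0) // mulVf // gt_eqF.
Qed.

Lemma to_simplex_bd b : usphere R n b -> polyhedron R (bdsimplex (1 + n)) (to_simplex b).
Proof.
move=> b1; have b0 := usphere_neq0 b1.
have S0 := sum_lift_min_gt0 b0; apply/polyhedron_bdsimplexP; split.
- by move=> i; rewrite mxE mulr_ge0 ?lift_min_ge0 // invr_ge0 ltW.
- under eq_bigr => j _ do rewrite mxE.
  by rewrite -mulr_sumr mulVf // gt_eqF.
- have [i mi] := padmin_attained b; exists i.
  by rewrite mxE lift_minE mi subrr mulr0.
Qed.

Lemma to_sphere_continuous w : polyhedron R (bdsimplex (1 + n)) w -> {for w, continuous to_sphere}.
Proof.
move=> Pw; have d0 := dotv_unpad_gt0 Pw.
have cu : {for w, continuous unpad} by apply: continuous_linear_fun; exact: unpad_linear.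
apply: (@cvgZ _ _ _ (nbhs w)) => //.
apply: (@cvgV _ _ (nbhs w)); first by rewrite sqrtr_eq0 -ltNge.
apply: (@continuous_comp _ _ _ (fun w => dotv (unpad w) (unpad w)) Num.sqrt); last exact: sqrt_continuous.
apply: (@continuous_comp _ _ _ unpad (fun r => dotv r r)) => //; exact: continuous_dotv.
Qed.

Lemma to_simplex_continuous b : usphere R n b -> {for b, continuous to_simplex}.
Proof.
move=> b1; have b0 := usphere_neq0 b1.
have S0 := sum_lift_min_gt0 b0.
apply: (@cvgZ _ _ _ (nbhs b)); last exact: continuous_lift_min.
apply: (@cvgV _ _ (nbhs b)); first by rewrite gt_eqF.
apply: continuous_big => [|i _]; first exact: add_continuous.
move=> c; apply: (@continuous_comp _ _ _ lift_min (fun u : 'rV[R]_(1 + n) => u 0 i)).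
  exact: continuous_lift_min.
exact: coord_continuous.
Qed.
End RadialProjection.

Lemma homeomorphic_sphere (R : realType) n m p
    (e : {linear 'rV[R]_n -> 'M[R]_(m, p)}) (q : {linear 'M[R]_(m, p) -> 'rV[R]_n}) :
  cancel e q ->
  homeomorphic (polyhedron R (bdsimplex (1 + n))) [set e r | r in usphere R n].
Proof.
move=> eK; exists (e \o @to_sphere R n), (@to_simplex R n \o q); split.
- apply: continuous_in_subspaceT => w /set_mem Pw.
  apply: (@continuous_comp _ _ _ (@to_sphere R n) e); first exact: to_sphere_continuous.
  exact: continuous_linear_mx.
- apply: continuous_in_subspaceT => _ /set_mem[r r1 <-].
  apply: (@continuous_comp _ _ _ q (@to_simplex R n)); first exact: continuous_linear_mx.
  by rewrite eK; exact: to_simplex_continuous.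
- by move=> w /to_sphere_usphere ?; exists (to_sphere w).
- by move=> _ [r r1 <-]; rewrite /= eK; exact: to_simplex_bd.
split=> [w Pw|_ [r r1 <-]] /=; first by rewrite eK to_simplex_sphere.
by rewrite eK to_sphere_simplex.
Qed.

Lemma is_SB_sphere (R : realType) n m p
    (e : {linear 'rV[R]_n -> 'M[R]_(m, p)}) (q : {linear 'M[R]_(m, p) -> 'rV[R]_n}) :
  (0 < n)%N -> cancel e q -> is_SB [set e r | r in usphere R n] 2.
Proof.
case: n e q => // n e q _ eK; exists n.+2, (bdsimplex n.+2); split.
- exact: bdsimplex_complex.
- exact: (homeomorphic_sphere eK).
- exact: sum_betti_bdsimplex.
Qed.

(** * The Killing form of su(n) *)

(** The family u may be linearly dependent: it only has to resolve the identity of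
    U.  This allows computing with the projections of the matrix units. *)
Lemma trace_on_frame (R : realType) (V : vectType R) (U : {vspace V})
    (f : {linear V -> V}) (I : finType) (u : I -> V) (phi : I -> {linear V -> R}) :
    (forall v, v \in U -> f v \in U) -> (forall i, u i \in U) ->
    (forall v, v \in U -> v = \sum_i phi i v *: u i) ->
  trace_on U f = \sum_i phi i (f (u i)).
Proof.
move=> fU uU frame; rewrite /trace_on.
have bU (i : 'I_(\dim U)) : (vbasis U)`_i \in U.
  by rewrite vbasis_mem // mem_nth // size_tuple.
transitivity (\sum_(i < \dim U) \sum_j phi j (f (vbasis U)`_i) * coord (vbasis U) i (u j)).
  apply: eq_bigr => i _; rewrite {1}(frame _ (fU _ (bU i))) linear_sum.
  by apply: eq_bigr => j _; rewrite linearZ.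
rewrite exchange_big; apply: eq_bigr => j _ /=.
rewrite [in RHS](coord_vbasis (uU j)) !linear_sum.
by apply: eq_bigr => i _; rewrite !linearZ /= mulrC.
Qed.

Section KillingForm.
Variables (R : realType) (n : nat).
Local Notation C := R[i].
Implicit Types X Y Z : 'M[C]_n.+1.

Lemma conjC_real (a : R) : Num.conj (a%:C)%C = (a%:C)%C :> C.
Proof. by rewrite conj_Creal ?complex_real. Qed.

Lemma tCZ k l (a : C) (Z : 'M[C]_(k, l)) : (a *: Z)^t* = Num.conj a *: Z^t*.
Proof. by apply/matrixP => i j; rewrite !mxE rmorphM. Qed.

Lemma tCM k l m (Y : 'M[C]_(k, l)) (Z : 'M[C]_(l, m)) : (Y *m Z)^t* = Z^t* *m Y^t*.
Proof. by rewrite trmx_mul map_mxM. Qed.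

Lemma tCD k l (Y Z : 'M[C]_(k, l)) : (Y + Z)^t* = Y^t* + Z^t*.
Proof. by rewrite raddfD /= map_mxD. Qed.

Lemma tCN k l (Z : 'M[C]_(k, l)) : (- Z)^t* = - Z^t*.
Proof. by rewrite raddfN /= map_mxN. Qed.

Lemma tCB k l (Y Z : 'M[C]_(k, l)) : (Y - Z)^t* = Y^t* - Z^t*.
Proof. by rewrite tCD tCN. Qed.

Lemma tCK k l (Z : 'M[C]_(k, l)) : Z^t*^t* = Z.
Proof. by apply/matrixP => i j; rewrite !mxE conjCK. Qed.

Lemma lie_su X Y : su X -> su Y -> su (lie X Y).
Proof.
move=> [Xs Xt] [Ys Yt]; split; last by rewrite /lie raddfB /= mxtrace_mulC subrr.
rewrite /lie tCB !tCM Xs Ys.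
by rewrite !mulNmx !mulmxN !opprK opprB.
Qed.

(** The projection of all matrices onto su(n): skew-Hermitian part, then traceless part. *)
Definition su_proj Z : 'M[C]_n.+1 :=
  2^-1 *: (Z - Z^t* - (\tr (Z - Z^t*) / n.+1%:R)%:M).

Lemma su_projP Z : su (su_proj Z).
Proof.
have e : (Z - Z^t*)^t* = - (Z - Z^t*).
  by rewrite tCB tCK opprB.
have trC (W : 'M[C]_n.+1) : \tr (W^t*) = Num.conj (\tr W).
  rewrite /mxtrace rmorph_sum; apply: eq_bigr => i _; by rewrite !mxE.
rewrite /su_proj; set W := Z - Z^t* in e *; split.
  rewrite tCZ fmorphV /= conjC_nat -scalerN; congr (_ *: _).
  rewrite tCB e [RHS]opprD; congr (_ + - _).
  rewrite tr_scalar_mx map_scalar_mx -scaleN1r scale_scalar_mx mulN1r; congr scalar_mx.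
  by rewrite /= rmorphM fmorphV /= conjC_nat -trC e raddfN /= mulNr.
by rewrite linearZ /= raddfB /= mxtrace_scalar -[X in _ - X]mulr_natr divfK ?pnatr_eq0 // subrr mulr0.
Qed.

Lemma su_proj_id Z : su Z -> su_proj Z = Z.
Proof.
move=> [Zs Zt]; rewrite /su_proj Zs opprK mxtraceD Zt addr0 mul0r raddf0 subr0.
by rewrite -mulr2n -[Z *+ 2]scaler_nat scalerA mulVf ?pnatr_eq0 // scale1r.
Qed.

Lemma lieP X (a : C) Y Z : lie X (a *: Y + Z) = a *: lie X Y + lie X Z.
Proof.
by rewrite /lie mulmxDr mulmxDl -scalemxAr -scalemxAl scalerBr opprD addrACA.
Qed.

Lemma lie_scalar X (a : C) : lie X a%:M = 0.
Proof. by rewrite /lie scalar_mxC subrr. Qed.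

Lemma su_proj_linear :
  linear (fun A : 'M[R]_(n.+1, n.+1 + n.+1) => realify (su_proj (unrealify A))).
Proof.
move=> a A B; rewrite unrealifyP -realify_scale -realifyD; congr realify.
move: (unrealify A) (unrealify B) => {A B} Y Z.
have anti : (a%:C)%C *: Y + Z - ((a%:C)%C *: Y + Z)^t* = (a%:C)%C *: (Y - Y^t*) + (Z - Z^t*).
  rewrite [((_ + _)^t*)](_ : _ = (a%:C)%C *: Y^t* + Z^t*).
    by rewrite scalerBr opprD addrACA.
  by apply/matrixP => i j; rewrite !mxE rmorphD rmorphM /= conjC_real.
rewrite /su_proj anti !linearP /= scalerA [_ * 2^-1]mulrC -scalerA -scalerDr; congr (_ *: _).
by rewrite mulrDl [(_ + _)%:M]raddfD /= -mulrA -scale_scalar_mx opprD addrACA -scalerBr.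
Qed.

Lemma mul_delta_mul k l m p (Y : 'M[C]_(k, l)) (Z : 'M[C]_(m, p)) a b c d :
  (Y *m delta_mx a b *m Z) c d = Y c a * Z b d.
Proof.
rewrite -mulmxA mxE (bigD1 a) //= big1 ?addr0 => [|i ia].
  rewrite mxE (bigD1 b) //= big1 ?addr0 => [|i ib]; first by rewrite !mxE !eqxx mul1r.
  by rewrite !mxE eqxx (negPf ib) mul0r.
rewrite mxE big1 ?mulr0 // => j _; by rewrite !mxE (negPf ia) mul0r.
Qed.

(** The complex trace of ad X \o ad Y on all matrices.  The cross terms
    X Z Y contribute products of traces. *)
Lemma ad2_trace X Y : \tr X = 0 ->
  \sum_i \sum_j lie X (lie Y (delta_mx i j)) i j = (2 * n.+1)%:R * \tr (X *m Y).
Proof.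
move=> tX.
have term i j : lie X (lie Y (delta_mx i j)) i j =
    (X *m Y) i i - X i i * Y j j - (Y i i * X j j - (Y *m X) j j).
  have e1 : X *m (Y *m delta_mx i j) = (X *m Y) *m delta_mx i j *m 1%:M.
    by rewrite mulmx1 mulmxA.
  have e2 : X *m (delta_mx i j *m Y) = X *m delta_mx i j *m Y by rewrite mulmxA.
  have e3 : (delta_mx i j *m Y) *m X = 1%:M *m delta_mx i j *m (Y *m X).
    by rewrite mul1mx mulmxA.
  have -> : lie X (lie Y (delta_mx i j)) =
      (X *m Y) *m delta_mx i j *m 1%:M - X *m delta_mx i j *m Y
      - (Y *m delta_mx i j *m X - 1%:M *m delta_mx i j *m (Y *m X)).
    by rewrite -e1 -e2 -e3 /lie mulmxBr mulmxBl.
  have sub k l (A B : 'M[C]_(k, l)) a b : (A - B) a b = A a b - B a b by rewrite !mxE.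
  by rewrite !sub !mul_delta_mul !mxE !eqxx mulr1 mul1r.
under eq_bigr => i _ do under eq_bigr => j _ do rewrite term.
under eq_bigr => i _ do rewrite !sumrB sumr_const card_ord -mulr_sumr -mulr_sumr
  -/(\tr Y) -/(\tr X) tX mulr0 sub0r opprK -/(\tr (Y *m X)).
rewrite big_split /= sumrB -mulr_suml -/(\tr X) tX mul0r subr0.
rewrite sumrMnl -/(\tr (X *m Y)) sumr_const card_ord (mxtrace_mulC Y X).
by rewrite -mulrnDr addnn -mul2n mulr_natl.
Qed.

Lemma Re_sum (I : Type) (r : seq I) (z : I -> C) :
  complex.Re (\sum_(i <- r) z i) = \sum_(i <- r) complex.Re (z i).
Proof. by apply: big_morph => // -[a b] [c d]. Qed.

Lemma Re_natM k (z : C) : complex.Re (k%:R * z) = k%:R * complex.Re z.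
Proof.
rewrite !mulr_natl; elim: k => [|k IH]; first by rewrite !mulr0n.
by rewrite !mulrS -IH; case: (z *+ k) => a b; case: (z).
Qed.

Lemma Re_half (z : C) : complex.Re (2^-1 * z) = 2^-1 * complex.Re z.
Proof.
have -> : 2^-1 = ((2^-1 : R)%:C)%C :> C by rewrite rmorphV ?unitfE ?pnatr_eq0 //= rmorph_nat.
by case: z => a b /=; rewrite mul0r subr0.
Qed.

Lemma Im_i (z : C) : complex.Im ('i * z) = complex.Re z.
Proof. by case: z => a b /=; rewrite mul0r mul1r add0r. Qed.

(** With x and y the entries coming from E_ij and E_ji, the terms for E_ij and i E_ij: their y parts cancel. *)
Lemma su_frame_coord (x y : C) :
  complex.Re (2^-1 * (x - y)) + complex.Im (2^-1 * ('i * x + 'i * y)) = complex.Re x.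
Proof.
rewrite -mulrDr mulrCA Im_i !Re_half -mulrDr.
by case: x => a b; case: y => c d /=; field.
Qed.

Lemma unrealify_delta_l (i j : 'I_n.+1) :
  unrealify (delta_mx i (lshift n.+1 j)) = delta_mx i j :> 'M[C]_n.+1.
Proof.
apply: realify_inj; rewrite unrealifyK; apply/matrixP => k l; rewrite !mxE.
by case: split_ordP => m ->; rewrite !mxE ?eq_lshift ?eq_rlshift ?andbF; case: (_ && _).
Qed.

Lemma unrealify_delta_r (i j : 'I_n.+1) :
  unrealify (delta_mx i (rshift n.+1 j)) = 'i *: delta_mx i j :> 'M[C]_n.+1.
Proof.
apply: realify_inj; rewrite unrealifyK; apply/matrixP => k l; rewrite !mxE.
case: split_ordP => m ->; rewrite !mxE ?eq_rshift ?eq_lrshift ?andbF;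
  by case: (_ && _); rewrite ?mulr1 ?mulr0.
Qed.

Lemma tC_delta (i j : 'I_n.+1) : (delta_mx i j)^t* = delta_mx j i :> 'M[C]_n.+1.
Proof. by apply/matrixP => k l; rewrite !mxE andbC conjC_nat. Qed.

(** The real trace over the projected matrix units equals the complex trace: the
    contributions of the adjoint units cancel between E_ij and i E_ij. *)
Lemma su_frame_trace (F : {linear 'M[C]_n.+1 -> 'M[C]_n.+1}) :
    (forall a, F a%:M = 0) ->
  \sum_i \sum_j realify (F (su_proj (unrealify (delta_mx i j)))) i j
  = complex.Re (\sum_i \sum_j F (delta_mx i j) i j).
Proof.
move=> F0.
have FZ a A : F (a *: A) = a *: F A by rewrite linearZ.
have FP Z : F (su_proj Z) = 2^-1 *: (F Z - F (Z^t*)).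
  have FB A B : F (A - B) = F A - F B by rewrite linearB.
  by rewrite /su_proj FZ !FB F0 subr0.
rewrite Re_sum; apply: eq_bigr => i _; rewrite Re_sum big_split_ord /= -big_split.
apply: eq_bigr => j _.
have coords (A B : 'M[C]_n.+1) : realify A i (lshift n.+1 j) + realify B i (rshift n.+1 j) =
    complex.Re (A i j) + complex.Im (B i j).
  by rewrite row_mxEl row_mxEr !mxE.
rewrite [LHS]coords.
rewrite unrealify_delta_l unrealify_delta_r !FP tCZ conjCi tC_delta !FZ.
rewrite -[RHS](su_frame_coord _ (F (delta_mx j i) i j)).
move: (F (delta_mx i j)) (F (delta_mx j i)) => A B.
by rewrite !mxE mulNr opprK.
Qed.

(** The maps ad X \o ad Y extend complex linearly to all matrices and kill scalars,
    so su_frame_trace reduces the trace on su(n) to ad2_trace. *)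
Lemma killingE X Y : su X -> su Y ->
  killing X Y = (2 * n.+1)%:R * complex.Re (\tr (X *m Y)).
Proof.
move=> Xs Ys.
have F_lin : linear (lie X \o lie Y) by move=> a Z W; rewrite /= !lieP.
pose F : {linear 'M[C]_n.+1 -> 'M[C]_n.+1} :=
  HB.pack (lie X \o lie Y) (GRing.isLinear.Build _ _ _ _ _ F_lin).
have F_scalar a : F a%:M = 0 by rewrite -[LHS]/(lie X (lie Y _)) lie_scalar /lie mul0mx mulmx0 subrr.
have F_su Z : su Z -> su (F Z) by move=> Zs; exact: lie_su Xs (lie_su Ys Zs).
have -> : killing X Y = trace_on (su_vspace R n.+1) (fun A => realify (F (unrealify A))) by [].
have : \sum_i \sum_j F (delta_mx i j) i j = (2 * n.+1)%:R * \tr (X *m Y).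
  exact: ad2_trace (proj2 Xs).
(* Only linearity, the two properties above and the trace of F matter below. *)
move: F_scalar F_su; clearbody F => F_scalar F_su trF.
have f_lin : linear (fun A : 'M[R]_(n.+1, n.+1 + n.+1) => realify (F (unrealify A))).
  by move=> a A B; rewrite unrealifyP linearP realifyD realify_scale.
pose f : {linear 'M[R]_(n.+1, n.+1 + n.+1) -> 'M[R]_(n.+1, n.+1 + n.+1)} :=
  HB.pack (fun A : 'M[R]_(n.+1, n.+1 + n.+1) => realify (F (unrealify A)))
    (GRing.isLinear.Build R _ _ _ _ f_lin).
pose c (k : 'I_n.+1 * 'I_(n.+1 + n.+1)) (A : 'M[R]_(n.+1, n.+1 + n.+1)) := A k.1 k.2.
have c_lin k : linear (c k) by move=> a A B; rewrite /c !mxE.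
pose phi k : {linear 'M[R]_(n.+1, n.+1 + n.+1) -> R} :=
  HB.pack (c k) (GRing.isLinear.Build R _ _ _ _ (c_lin k)).
pose P : {linear 'M[R]_(n.+1, n.+1 + n.+1) -> 'M[R]_(n.+1, n.+1 + n.+1)} :=
  HB.pack (fun A : 'M[R]_(n.+1, n.+1 + n.+1) => realify (su_proj (unrealify A)))
    (GRing.isLinear.Build R _ _ _ _ su_proj_linear).
have PE A : P A = realify (su_proj (unrealify A)) by [].
pose u (k : 'I_n.+1 * 'I_(n.+1 + n.+1)) := P (delta_mx k.1 k.2).
rewrite (@trace_on_frame _ _ _ f _ u phi); first last.
- move=> v vsu; have vs : su (unrealify v) by apply/mem_su_vspace; rewrite unrealifyK.
  have Pv : P v = v by rewrite PE su_proj_id ?unrealifyK.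
  rewrite -[LHS]Pv {1}(matrix_sum_delta v) linear_sum.
  under eq_bigr => i _ do (rewrite linear_sum; under eq_bigr => j _ do rewrite linearZ).
  by rewrite pair_bigA; exact: eq_bigr.
- by move=> k; apply/mem_su_vspace/su_projP.
- move=> v; rewrite -[v]unrealifyK => /mem_su_vspace vs.
  by rewrite /f /= realifyK; apply/mem_su_vspace; exact: F_su.
have -> : (2 * n.+1)%:R * complex.Re (\tr (X *m Y)) =
    complex.Re (\sum_i \sum_j F (delta_mx i j) i j).
  by rewrite trF Re_natM.
rewrite -su_frame_trace // pair_bigA; apply: eq_bigr => k _.
by rewrite /phi /f /= /c /u PE !realifyK.
Qed.
End KillingForm.

(** * The splitting of su(1 + n) into block diagonal and off-diagonal parts *)

Section HermitianRows.
Variables (R : realType) (n : nat).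
Local Notation C := R[i].
Implicit Types b c u w : 'rV[C]_n.

(** The real part of the Hermitian product, that is the Euclidean product of C^n = R^(2 n). *)
Definition redot b c : R := complex.Re ((b *m c^t*) 0 0).

Lemma redotE b c : redot b c = dotv (realify b) (realify c).
Proof.
rewrite /redot /dotv mxE Re_sum big_split_ord /= -big_split; apply: eq_bigr => i _ /=.
rewrite /realify !row_mxEl !row_mxEr !mxE.
by case: (b 0 i) (c 0 i) => [x y] [z t] /=; rewrite mulrN opprK.
Qed.

Lemma redotC b c : redot b c = redot c b.
Proof. by rewrite !redotE dotvC. Qed.

Lemma redotDr b c u : redot b (c + u) = redot b c + redot b u.
Proof. by rewrite !redotE realifyD dotvDr. Qed.

Lemma redotZr (a : R) b c : redot b ((a%:C)%C *: c) = a * redot b c.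
Proof. by rewrite !redotE realify_scale dotvZr. Qed.

Lemma redot_eq0 b : (redot b b == 0) = (b == 0).
Proof.
rewrite redotE dotv_eq0 -(inj_eq (@realify_inj _ _ _)); congr (_ == _).
by apply/rowP => i; rewrite !mxE; case: split_ordP => j _; rewrite !mxE.
Qed.

Lemma redot_ge0 b : 0 <= redot b b.
Proof. by rewrite redotE dotv_ge0. Qed.

Lemma skew11 (M : 'M[C]_1) : M^t* = - M -> complex.Re (M 0 0) = 0.
Proof.
move/matrixP/(_ 0 0); rewrite !mxE; case: (M 0 0) => x y [] xx.
by rewrite -[LHS]/x; lra.
Qed.

Lemma herm11 (M : 'M[C]_1) : M^t* = M -> M 0 0 = ((complex.Re (M 0 0))%:C)%C.
Proof.
move/matrixP/(_ 0 0); rewrite !mxE; case: (M 0 0) => x y [] yy.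
by congr (Complex _ _); lra.
Qed.

Lemma Re0_conj (z : C) : complex.Re z = 0 -> Num.conj z = - z.
Proof. by case: z => x y /= ->; rewrite -[LHS]/(0 -i* y)%C; apply/eqP; rewrite eq_complex /= oppr0 !eqxx. Qed.

Lemma row_sqr_norm b : b *m b^t* = ((redot b b)%:C)%C%:M.
Proof.
by rewrite [LHS]mx11_scalar herm11 // tCM tCK.
Qed.

Definition off b : 'M[C]_(1 + n) := block_mx 0 b (- b^t*) 0.
Definition diagb (k : 'M[C]_1) (A : 'M[C]_n) : 'M[C]_(1 + n) := block_mx k 0 0 A.

Lemma off_add (a : C) b c : Num.conj a = a -> off (a *: b + c) = a *: off b + off c.
Proof.
move=> ar; rewrite /off scale_block_mx add_block_mx !scaler0 !addr0; congr block_mx.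
by rewrite [(_ + _)^t*](_ : _ = a *: b^t* + c^t*) ?opprD ?scalerN //;
  apply/matrixP => i j; rewrite !mxE rmorphD rmorphM /= ar.
Qed.

Lemma off_inj : injective off.
Proof. by move=> b c /eq_block_mx[]. Qed.

Lemma off_su b : su (off b).
Proof.
split; last by rewrite mxtrace_block !raddf0 addr0.
rewrite /off tr_block_mx map_block_mx opp_block_mx !trmx0 !map_mx0 !oppr0 opprK.
by congr block_mx; rewrite linearN map_mxN tCK.
Qed.

Lemma diagb_su k A : k^t* = - k -> A^t* = - A -> \tr k + \tr A = 0 -> su (diagb k A).
Proof.
move=> kk AA tr0; split; last by rewrite mxtrace_block.
by rewrite /diagb tr_block_mx map_block_mx opp_block_mx !trmx0 !map_mx0 !oppr0 kk AA.
Qed.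

Lemma su_split (X : 'M[C]_(1 + n)) : su X -> exists k A u,
  [/\ k^t* = - k, A^t* = - A, \tr k + \tr A = 0 & X = diagb k A + off u].
Proof.
rewrite -[X]submxK; set k := ulsubmx X; set u := ursubmx X; set l := dlsubmx X; set A := drsubmx X.
case; rewrite tr_block_mx map_block_mx opp_block_mx mxtrace_block.
move=> /eq_block_mx[kk lu ul AA] tr0; exists k, A, u; split=> //.
by rewrite /diagb /off add_block_mx !addr0 !add0r ul opprK.
Qed.

Lemma lie_diag_off k A b : k^t* = - k -> A^t* = - A ->
  lie (diagb k A) (off b) = off (k *m b - b *m A).
Proof.
move=> kk AA; rewrite /lie /diagb /off !mulmx_block opp_block_mx add_block_mx.
rewrite !(mulmx0, mul0mx, addr0, add0r, subr0, oppr0, sub0r).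
congr block_mx.
rewrite tCB !tCM kk AA !(mulmxN, mulNmx) opprK.
by rewrite opprB opprK.
Qed.

Lemma lie_off_off u b :
  lie (off u) (off b) = diagb (b *m u^t* - u *m b^t*) (b^t* *m u - u^t* *m b).
Proof.
rewrite /lie /diagb /off !mulmx_block opp_block_mx add_block_mx.
rewrite !(mulmx0, mul0mx, addr0, add0r, subr0, oppr0, sub0r, mulmxN, mulNmx, opprK).
by congr block_mx; rewrite addrC.
Qed.

Lemma diag_off_inj k A b l B c : diagb k A + off b = diagb l B + off c ->
  [/\ k = l, A = B & b = c].
Proof.
by rewrite !add_block_mx !(addr0, add0r) => /eq_block_mx[].
Qed.

Lemma tr_diag_off k A w : \tr (diagb k A *m off w) = 0.
Proof.
by rewrite mulmx_block mxtrace_block !(mulmx0, mul0mx, addr0, add0r, raddf0).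
Qed.

Lemma tr_off_off u w : complex.Re (\tr (off u *m off w)) = - 2 * redot u w.
Proof.
rewrite mulmx_block mxtrace_block !(mulmx0, mul0mx, addr0, add0r) mulNmx mulmxN.
rewrite !linearN /= (mxtrace_mulC (u^t*) w) /mxtrace !big_ord1.
have := redotC u w; rewrite /redot.
by case: (_ 0 0) => a b; case: (_ 0 0) => c d /= ->; ring.
Qed.

(** Block diagonal elements generate isometries of C^n, whose velocities are orthogonal to the position. *)
Lemma redot_tangent k A b : k^t* = - k -> A^t* = - A -> redot b (k *m b - b *m A) = 0.
Proof.
move=> kk AA; rewrite redotC /redot mulmxBl; apply: skew11.
rewrite -!mulmxA row_sqr_norm tCB !tCM kk AA tCK.
rewrite tr_scalar_mx map_scalar_mx /= conjC_real !(mulmxN, mulNmx) scalar_mxC mulmxA.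
by rewrite opprB opprK addrC.
Qed.

(** The rank two matrix w^* b - b^* w moves b in the direction w up to a complex
    multiple of b; the imaginary multiple produced by it and by the trace
    condition is compensated by a multiple of b^* b. *)
Lemma isotropy_onto_tangent b w : redot b b = 1 -> redot b w = 0 -> exists k A,
  [/\ k^t* = - k, A^t* = - A, \tr k + \tr A = 0 & k *m b - b *m A = w].
Proof.
move=> b1 bw.
pose c := (b *m w^t*) 0 0.
have bwE : b *m w^t* = c%:M by rewrite [LHS]mx11_scalar.
have bbE : b *m b^t* = 1%:M by rewrite row_sqr_norm b1.
have cc : Num.conj c = - c by apply: Re0_conj.
have wbE : w *m b^t* = - c%:M.
  rewrite -(tCK w) -tCM bwE.
  by apply/matrixP => i j; rewrite !mxE !ord1 eqxx /= !mulr1n cc.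
(* The coefficient of c b in k b - b A is - (3 + 2 s). *)
pose s : C := - (3 / 2).
have sr : Num.conj s = s by rewrite /s rmorphN rmorphM fmorphV /= !conjC_nat.
pose A := w^t* *m b - b^t* *m w + (s * c) *: (b^t* *m b).
exists (- (\tr A)%:M), A.
have AA : A^t* = - A.
  rewrite /A tCD tCB tCZ !tCM !tCK rmorphM /= sr cc mulrN scaleNr.
  by rewrite [RHS]opprD opprB.
have bA : b *m A = - w + c *: b + (s * c) *: b.
  rewrite /A !mulmxDr mulmxN -scalemxAr !mulmxA bwE bbE !mul1mx mul_scalar_mx.
  by rewrite [- w + _]addrC.
have trA : \tr A = (2 + s) * c.
  rewrite /A mxtraceD mxtraceZ [\tr (_ - _)]raddfB /= !(mxtrace_mulC (_^t*)) bwE wbE bbE.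
  rewrite [\tr (- _)]raddfN /= !mxtrace_scalar /=; ring.
split=> //.
- rewrite tCN tr_scalar_mx map_scalar_mx; congr (- _).
  rewrite trA -[RHS]raddfN /= -mulrN -cc; congr (_%:M).
  by rewrite rmorphM rmorphD /= sr conjC_nat.
- by rewrite [\tr (- _)]raddfN /= mxtrace_scalar addNr.
rewrite bA trA mulNmx mul_scalar_mx.
have -> : - ((2 + s) * c *: b) - (- w + c *: b + s * c *: b) = w - ((3 + 2 * s) * c) *: b.
  by apply/rowP => i; rewrite !mxE; ring.
have -> : 3 + 2 * s = 0 by rewrite /s mulrN mulrC divfK ?subrr ?pnatr_eq0.
by rewrite mul0r scale0r subr0.
Qed.

(** Multiplying the second equation by b on the left gives u = (b u^* ) b, and the
    first one says that the scalar b u^* is real. *)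
Lemma parallel_of_commuting u b : redot b b = 1 ->
    b *m u^t* = u *m b^t* -> b^t* *m u = u^t* *m b ->
  u = ((redot b u)%:C)%C *: b.
Proof.
move=> b1 sym her.
have bbE : b *m b^t* = 1%:M by rewrite row_sqr_norm b1.
have uE : u = (b *m u^t*) *m b by rewrite -mulmxA -her mulmxA bbE mul1mx.
rewrite {1}uE [b *m u^t*]mx11_scalar mul_scalar_mx herm11 //.
by rewrite tCM tCK sym.
Qed.
End HermitianRows.

(** * The sphere of off-diagonal matrices and its tangent spaces *)

Section OffSphere.
Variables (R : realType) (n : nat).
Local Notation C := R[i].
Implicit Types b c u w : 'rV[C]_n.

Definition off_sphere : set 'M[C]_(1 + n) := [set off b | b in [set b | redot b b = 1]].

Definition offr (r : 'rV[R]_(n + n)) : 'M[R]_(1 + n, (1 + n) + (1 + n)) :=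
  realify (off (unrealify r)).

Lemma offr_linear : linear offr.
Proof.
by move=> a r s; rewrite /offr unrealifyP off_add ?conjC_real // realifyD realify_scale.
Qed.
HB.instance Definition _ := GRing.isLinear.Build R _ _ _ offr offr_linear.

Definition corner (A : 'M[R]_(1 + n, (1 + n) + (1 + n))) : 'rV[R]_(n + n) :=
  realify (ursubmx (unrealify A)).

Lemma corner_linear : linear corner.
Proof.
move=> a A B; rewrite /corner -realify_scale -realifyD unrealifyP; congr realify.
by apply/matrixP => i j; rewrite !mxE.
Qed.
HB.instance Definition _ := GRing.isLinear.Build R _ _ _ corner corner_linear.

Lemma offrK : cancel offr corner.
Proof. by move=> r; rewrite /corner /offr realifyK /off block_mxKur unrealifyK. Qed.

Lemma realify_off_sphere : [set realify y | y in off_sphere] = [set offr r | r in usphere R (n + n)].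
Proof.
apply/seteqP; split=> [_ [_ [b b1 <-] <-]|_ [r r1 <-]].
  exists (realify b); first by rewrite /usphere /= -redotE.
  by rewrite /offr realifyK.
exists (off (unrealify r)) => //; exists (unrealify r) => //.
by rewrite /= redotE unrealifyK.
Qed.

Lemma mtangent_off b : redot b b = 1 ->
  mtangent off_sphere (off b) = [set off w | w in [set w | redot b w = 0]].
Proof.
move=> b1; rewrite /mtangent realify_off_sphere.
have -> : realify (off b) = offr (realify b) by rewrite /offr realifyK.
rewrite (tangent_sphere offrK); last by rewrite /usphere /= -redotE.
apply/seteqP; split=> [v [s bs]|_ [w bw <-]].
  rewrite /offr => /realify_inj <-; exists (unrealify s) => //.
  by rewrite /= redotE unrealifyK.
by exists (realify w); rewrite /= -?redotE // /offr realifyK.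
Qed.

Lemma submanifold_off_sphere : submanifold [set realify y | y in off_sphere].
Proof. by rewrite realify_off_sphere; exact: submanifold_sphere offrK. Qed.

Lemma fund_diag_off k A u b : k^t* = - k -> A^t* = - A ->
  fund (diagb k A + off u) (off b) =
    diagb (b *m u^t* - u *m b^t*) (b^t* *m u - u^t* *m b) + off (k *m b - b *m A).
Proof.
move=> kk AA; rewrite -(lie_diag_off _ kk AA) -lie_off_off addrC.
by rewrite /fund /lie mulmxDl mulmxDr opprD addrACA.
Qed.

(** The off-diagonal part of the bracket is always tangent, so only the block diagonal part matters. *)
Lemma fund_off_tangent k A u b : k^t* = - k -> A^t* = - A -> redot b b = 1 ->
  mtangent off_sphere (off b) (fund (diagb k A + off u) (off b)) <->
  b *m u^t* = u *m b^t* /\ b^t* *m u = u^t* *m b.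
Proof.
move=> kk AA b1; rewrite mtangent_off // fund_diag_off //; split.
  case=> w _; rewrite -[off w]add0r (_ : 0 = diagb 0 0); last first.
    by rewrite /diagb -block_mx0.
  by move/diag_off_inj => [/esym/eqP + /esym/eqP]; rewrite !subr_eq0 => /eqP -> /eqP ->.
move=> [-> ->]; exists (k *m b - b *m A); first exact: redot_tangent.
by rewrite !subrr /diagb block_mx0 add0r.
Qed.
End OffSphere.

(** * The Lagrangian property and the zeros of transversal fields *)

Section Tightness.
Variables (R : realType) (n : nat).
Local Notation C := R[i].
Implicit Types b c u w : 'rV[C]_n.

(** Invariance of the trace form under brackets. *)
Lemma KKS_fund (x X Y : 'M[C]_(1 + n)) : su x -> su X -> su Y ->
  KKS x X Y = (2 * n.+1)%:R * complex.Re (\tr (X *m fund Y x)).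
Proof.
move=> xs Xs Ys; rewrite /KKS (killingE xs (lie_su Xs Ys)); congr (_ * complex.Re _).
rewrite /fund /lie !mulmxBr !raddfB /= (mxtrace_mulC x (X *m Y)) mulmxA; congr (_ - _).
  by rewrite mulmxA.
by rewrite (mxtrace_mulC X).
Qed.

(** A tangent vector is realized by a block diagonal X, which is trace-orthogonal
    to the tangent space.  Conversely, the off-diagonal part u of an X that is
    orthogonal to the tangent space has no component orthogonal to b, so it does
    not contribute to the bracket with off b. *)
Lemma lagrangian_off_sphere b : redot b b = 1 ->
  mtangent (@off_sphere R n) (off b) =
  [set fund X (off b) | X in [set X | su X /\
    forall Y, su Y -> mtangent (@off_sphere R n) (off b) (fund Y (off b)) -> KKS (off b) X Y = 0]].
Proof.
move=> b1; rewrite mtangent_off //; apply/seteqP; split=> [_ [w bw <-]|_ [X [Xs XT] <-]].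
  have [k [A [kk AA tr0 kbA]]] := isotropy_onto_tangent b1 bw.
  exists (diagb k A); last by rewrite /fund lie_diag_off // kbA.
  have Xs : su (diagb k A) by exact: diagb_su.
  split=> // Y Ys [w' _ ww']; rewrite (KKS_fund (off_su b) Xs Ys) -ww' tr_diag_off.
  by rewrite mulr0.
have [k [A [u [kk AA tr0 XE]]]] := su_split Xs.
have uT w : redot b w = 0 -> redot u w = 0.
  move=> bw; have [l [B [ll BB trl lbB]]] := isotropy_onto_tangent b1 bw.
  have Ys : su (diagb l B) by exact: diagb_su.
  have YE : fund (diagb l B) (off b) = off w by rewrite /fund lie_diag_off // lbB.
  have := XT _ Ys; rewrite YE => /(_ (ex_intro2 _ _ w bw erefl)).
  rewrite (KKS_fund (off_su b) Xs Ys) YE XE mulmxDl mxtraceD tr_diag_off add0r tr_off_off.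
  by move/eqP; rewrite !mulf_eq0 oppr_eq0 !pnatr_eq0 /= => /eqP.
(* The component of u orthogonal to b; it is orthogonal to itself. *)
pose w := u - ((redot b u)%:C)%C *: b.
have wE : w = (((- redot b u)%:C)%C *: b + u) by rewrite /w rmorphN scaleNr addrC.
have bw : redot b w = 0.
  by rewrite wE redotDr redotZr b1 mulr1 addNr.
have w0 : w = 0.
  apply/eqP; rewrite -redot_eq0 {2}wE redotDr redotZr (redotC w b) bw mulr0 add0r (redotC w u).
  by rewrite uT.
have uE : u = ((redot b u)%:C)%C *: b by apply/eqP; rewrite -subr_eq0 -/w w0.
rewrite XE -(mtangent_off b1); apply/(fund_off_tangent u kk AA b1).
rewrite uE; split; first by rewrite tCZ conjC_real -scalemxAl -scalemxAr.
by rewrite tCZ conjC_real -scalemxAl -scalemxAr.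
Qed.

Lemma redot_delta (z : C) (i : 'I_n) :
  redot (z *: delta_mx 0 i) (z *: delta_mx 0 i) = complex.Re (z * Num.conj z).
Proof.
rewrite /redot tCZ -scalemxAl -scalemxAr scalerA; congr complex.Re.
have -> : (delta_mx 0 i : 'rV[C]_n)^t* = delta_mx i 0.
  by apply/matrixP => k l; rewrite !mxE andbC conjC_nat.
by rewrite mul_delta_mx !mxE !eqxx mulr1.
Qed.

Lemma infinite_off_sphere : (0 < n)%N -> infinite_set (@off_sphere R n).
Proof.
move=> n0 fin; pose i0 : 'I_n := Ordinal n0.
(* Unit vectors on a complex line, told apart by their real parts 1/(k + 1). *)
pose s (k : nat) : R := k.+1%:R^-1.
pose z k : C := (s k +i* Num.sqrt (1 - s k ^+ 2))%C.
pose b k : 'rV[C]_n := z k *: delta_mx 0 i0.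
have s1 k : 0 <= 1 - s k ^+ 2.
  by rewrite subr_ge0 exprn_ile1 ?invr_ge0 ?ler0n // invf_le1 ?ltr0n // ler1n.
have inj : injective (fun k => off (b k)).
  move=> k l /off_inj/rowP/(_ i0); rewrite !mxE !eqxx !mulr1 => -[/invr_inj/eqP].
  by rewrite eqr_nat => /eqP[].
have /infinite_nat : finite_set [set: nat].
  have := finite_preimage (fun k l _ _ kl => inj k l kl) fin.
  apply: sub_finite_set => k _; exists (b k) => //=.
  by rewrite redot_delta /= mulrN opprK -!expr2 sqr_sqrtr // addrC subrK.
by [].
Qed.

(** With off-diagonal part 0 every bracket is tangent and transversality would make
    all points zeros; otherwise tangency singles out the two unit vectors on the
    real line through u, and transversality makes them zeros. *)
Lemma fL_off (X : 'M[C]_(1 + n)) : (0 < n)%N -> su X -> Defs.transversal (@off_sphere R n) X ->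
  exists2 b, redot b b = 1 & fL (@off_sphere R n) X = [set off b; off (- b)].
Proof.
move=> n0 Xs [tX1 tX2]; have [k [A [u [kk AA tr0 XE]]]] := su_split Xs.
have tangentP b (b1 : redot b b = 1) :
    mtangent (@off_sphere R n) (off b) (fund X (off b)) <->
    b *m u^t* = u *m b^t* /\ b^t* *m u = u^t* *m b.
  by rewrite XE; exact: fund_off_tangent.
have inL b : redot b b = 1 -> off_sphere (off b) by move=> b1; exists b.
have fLP b (b1 : redot b b = 1) :
    b *m u^t* = u *m b^t* /\ b^t* *m u = u^t* *m b -> fL (@off_sphere R n) X (off b).
  by move=> /(tangentP b b1) tb; split=> //; [exact: inL|exact: tX1 (inL _ b1) tb].
have [u0|u0] := eqVneq u 0.
  case: (infinite_off_sphere n0); apply: sub_finite_set tX2 => _ [b b1 <-].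
  apply: fLP => //; rewrite u0 [(0 : 'rV[C]_n)^t*](_ : _ = 0); last first.
    by apply/matrixP => i j; rewrite !mxE conjC0.
  by rewrite !mulmx0 !mul0mx.
have N0 : 0 < redot u u by rewrite lt_def redot_eq0 u0 redot_ge0.
pose rho := Num.sqrt (redot u u).
have r0 : 0 < rho by rewrite sqrtr_gt0.
have rr : rho ^+ 2 = redot u u by rewrite sqr_sqrtr // ltW.
pose b0 := ((rho^-1)%:C)%C *: u.
have b01 : redot b0 b0 = 1.
  by rewrite redotZr redotC redotZr -rr mulrA -expr2 exprVn mulVf // sqrf_eq0 gt_eqF.
have line (a : R) : let b := (a%:C)%C *: u in
    b *m u^t* = u *m b^t* /\ b^t* *m u = u^t* *m b.
  by rewrite /= tCZ conjC_real -!scalemxAl -!scalemxAr.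
exists b0 => //; apply/seteqP; split=> [_ [[b b1 <-] fb tb]|_ [->|->]].
- have [sym her] := (tangentP b b1).1 tb.
  have uE := parallel_of_commuting b1 sym her; set a := redot b u in uE.
  have aa : a ^+ 2 = rho ^+ 2.
    by rewrite rr {2}uE redotZr redotC expr2.
  have bE : b = ((a^-1)%:C)%C *: u.
    rewrite uE scalerA -rmorphM mulVf ?scale1r //.
    by rewrite -sqrf_eq0 aa sqrf_eq0 gt_eqF.
  move/eqP: aa; rewrite eqf_sqr => /orP[] /eqP ar; rewrite bE ar; [left|right] => //.
  by rewrite /b0 -scaleNr -rmorphN invrN.
- by apply: fLP => //; exact: line.
- apply: fLP.
    rewrite -scaleNr -rmorphN redotZr redotC redotZr -rr mulrA mulrNN -expr2 exprVn mulVf //.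
    by rewrite sqrf_eq0 gt_eqF.
  by rewrite -scaleNr -rmorphN; exact: line.
Qed.
End Tightness.

(** * The actions of U(2) and SU(3) *)

Section Flag.
Variable R : realType.
Local Notation C := R[i].

Lemma norm_row2 (b : 'rV[C]_2) :
  `|b 0 0| ^+ 2 + `|b 0 1| ^+ 2 = ((redot b b)%:C)%C.
Proof.
have /matrixP/(_ 0 0) := row_sqr_norm b; rewrite !mxE eqxx mulr1n => <-.
rewrite !big_ord_recl big_ord0 addr0 !mxE !normCK.
by congr (_ + b _ _ * Num.conj (b _ _)); apply/val_inj.
Qed.

Lemma sphereLE : sphereL R = @off_sphere R 2.
Proof.
apply/seteqP; split=> [_ [b [b1 ->]]|_ [b b1 <-]]; exists b => //=.
  by move: b1; rewrite norm_row2 => -[].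
by rewrite norm_row2 b1.
Qed.

Lemma HmxE : Hmx R = block_mx ((2 * 'i)%:M : 'M[C]_1) 0 0 ((- 'i)%:M : 'M[C]_2) :> 'M[C]_(1 + 2).
Proof.
apply/matrixP => i j; rewrite !mxE.
case: split_ordP => i' ->; rewrite mxE; case: split_ordP => j' ->; rewrite !mxE.
- by rewrite !ord1 /= mulr1n mulrC.
- by rewrite -val_eqE /= ord1 mulr0n mulr0.
- by rewrite -val_eqE /= ord1 mulr0n mulr0.
rewrite -val_eqE /= eqn_add2l val_eqE; case: eqP => [->|_]; last by rewrite !mulr0n mulr0.
by rewrite !mulr1n; case: j' => -[|[|//]] ? /=; rewrite mulrN1.
Qed.

Lemma block_unitary m p (A : 'M[C]_m) (B : 'M[C]_p) :
  block_mx A 0 0 B \is unitarymx = (A \is unitarymx) && (B \is unitarymx).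
Proof.
apply/unitarymxP/andP; rewrite tr_block_mx map_block_mx mulmx_block !trmx0 !map_mx0.
  rewrite !(mulmx0, mul0mx, addr0, add0r) scalar_mx_block => /eq_block_mx[AA _ _ BB].
  by split; apply/unitarymxP.
case=> /unitarymxP AA /unitarymxP BB.
by rewrite !(mulmx0, mul0mx, addr0, add0r) AA BB -scalar_mx_block.
Qed.

Lemma unitary11 (z : C) : (z%:M : 'M[C]_1) \is unitarymx = (`|z| == 1).
Proof.
apply/unitarymxP/eqP; rewrite tr_scalar_mx map_scalar_mx -scalar_mxM -normCK.
  by move/matrixP/(_ 0 0); rewrite !mxE eqxx !mulr1n => /eqP; rewrite sqrp_eq1 // => /eqP.
by move=> ->; rewrite expr1n.
Qed.

Lemma block_scalar_comm m p (k l : C) (z : C) (h : 'M[C]_p) :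
  block_mx (z%:M : 'M[C]_m) 0 0 h *m block_mx k%:M 0 0 l%:M =
  block_mx k%:M 0 0 l%:M *m block_mx z%:M 0 0 h.
Proof.
by rewrite !mulmx_block !(mulmx0, mul0mx, addr0, add0r) scalar_mxC [h *m _]scalar_mxC.
Qed.

(** The eigenvalues 2i and -i of H differ, so a matrix commuting with H preserves both eigenspaces. *)
Lemma U_H_centralizer :
  U_H R = [set g : 'M[C]_3 | SU g /\ g *m Hmx R = Hmx R *m g].
Proof.
apply/seteqP; split=> g [gSU].
  move=> [z [h [z1 hu gE]]]; split=> //; rewrite gE HmxE; exact: (@block_scalar_comm 1 2).
move=> gH; split=> //; pose G : 'M[C]_(1 + 2) := g.
have : G *m block_mx ((2 * 'i)%:M : 'M[C]_1) 0 0 (- 'i)%:M =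
       block_mx ((2 * 'i)%:M : 'M[C]_1) 0 0 (- 'i)%:M *m G by rewrite -HmxE.
rewrite -[G]submxK !mulmx_block.
rewrite !(mulmx0, mul0mx, addr0, add0r) => /eq_block_mx[_ ur dl _].
have i3 : 3 * 'i != 0 :> C by rewrite mulf_neq0 ?pnatr_eq0 // neq0Ci.
have ur0 : ursubmx G = 0.
  move/eqP: ur; rewrite mul_scalar_mx mul_mx_scalar -subr_eq0 -scalerBl.
  rewrite scaler_eq0 => /orP[|/eqP //].
  by rewrite (_ : _ - _ = - (3 * 'i)) ?oppr_eq0 ?(negPf i3) //; ring.
have dl0 : dlsubmx G = 0.
  move/eqP: dl; rewrite mul_scalar_mx mul_mx_scalar -subr_eq0 -scalerBl.
  rewrite scaler_eq0 => /orP[|/eqP //].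
  by rewrite (_ : _ - _ = 3 * 'i) ?(negPf i3) //; ring.
have GE : G = block_mx (ulsubmx G) 0 0 (drsubmx G) by rewrite -[LHS]submxK ur0 dl0.
have : G \is unitarymx := gSU.1.
rewrite GE block_unitary [ulsubmx _]mx11_scalar unitary11 => /andP[/eqP z1 hu].
by exists (ulsubmx G 0 0), (drsubmx G); split=> //; rewrite -mx11_scalar -GE.
Qed.

Lemma conj_off (z : C) (h : 'M[C]_2) (b : 'rV[C]_2) : `|z| = 1 -> h \is unitarymx ->
  let g := block_mx (z%:M : 'M[C]_1) 0 0 h in
  g *m off b *m invmx g = off (z *: (b *m h^t*)).
Proof.
move=> z1 hu /=; have gu : block_mx (z%:M : 'M[C]_1) 0 0 h \is unitarymx.
  by rewrite block_unitary unitary11 z1 eqxx.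
rewrite (invmx_unitary gu) tr_block_mx map_block_mx !trmx0 !map_mx0 /off !mulmx_block.
rewrite !(mulmx0, mul0mx, addr0, add0r) tr_scalar_mx map_scalar_mx.
congr block_mx; first by rewrite mul_scalar_mx scalemxAl.
by rewrite tCZ tCM tCK mulmxN mulNmx mul_mx_scalar.
Qed.

Lemma redot_unitary (z : C) (h : 'M[C]_2) (b : 'rV[C]_2) : `|z| = 1 -> h \is unitarymx ->
  redot (z *: (b *m h^t*)) (z *: (b *m h^t*)) = redot b b.
Proof.
move=> z1 hu; rewrite /redot tCZ tCM tCK -scalemxAl -scalemxAr scalerA -normCK z1 expr1n scale1r.
have hh : h^t* *m h = 1%:M by apply: mulmx1C; apply/unitarymxP.
by rewrite -mulmxA (mulmxA (h^t*)) hh mul1mx.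
Qed.

Definition e0 : 'rV[C]_2 := delta_mx 0 0.

Lemma redot_e0 : redot e0 e0 = 1.
Proof. by rewrite -[e0]scale1r redot_delta conjC1 mulr1. Qed.

Lemma det22 (A : 'M[C]_2) : \det A = A 0 0 * A 1 1 - A 0 1 * A 1 0.
Proof.
rewrite (expand_det_row _ 0) !big_ord_recl big_ord0 addr0 /cofactor !det_mx11 !mxE.
rewrite /= expr0 mul1r expr1 mulN1r mulrN.
by congr (A _ _ * A _ _ - A _ _ * A _ _); apply/val_inj.
Qed.

(** The second row of the adjoint of h is the usual completion of b to a matrix of SU(2). *)
Lemma SU2_transitive (b : 'rV[C]_2) : redot b b = 1 ->
  exists2 h : 'M[C]_2, h \is unitarymx /\ \det h = 1 & e0 *m h^t* = b.
Proof.
move=> b1; set x := b 0 0; set y := b 0 1.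
have xy : x * Num.conj x + y * Num.conj y = 1.
  by have := norm_row2 b; rewrite b1 !normCK.
pose h : 'M[C]_2 := \matrix_(i, j)
  nth 0 (nth [::] [:: [:: Num.conj x; - y]; [:: Num.conj y; x]] i) j.
exists h.
  split; last by rewrite det22 !mxE /= -xy; ring.
  apply/unitarymxP/matrixP => i j; rewrite !mxE !big_ord_recl big_ord0 addr0 !mxE.
  case: i => -[|[|//]] i2; case: j => -[|[|//]] j2 /=;
    rewrite ?rmorphN /= ?conjCK -?xy; ring.
apply/matrixP => i j; rewrite /e0 -rowE !mxE ord1.
by case: j => -[|[|//]] j2 /=; rewrite conjCK /x /y; congr (b _ _); apply/val_inj.
Qed.

Lemma sphere_orbit : sphereL R = conj_orbit (U_H R) (off e0).
Proof.
rewrite sphereLE; apply/seteqP; split=> [_ [b b1 <-]|_ [g [gSU [z [h [z1 hu ->]]]] <-]].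
  have [h [hu h1] hb] := SU2_transitive b1.
  exists (block_mx (1%:M : 'M[C]_1) 0 0 h); last by rewrite conj_off ?normr1 // scale1r hb.
  split; last by exists 1, h; rewrite normr1.
  split; first by rewrite (block_unitary (1%:M : 'M[C]_1) h) unitary11 normr1 eqxx.
  by rewrite (det_ublock (1%:M : 'M[C]_1) 0 h) det1 mul1r.
exists (z *: (e0 *m h^t*)); first by rewrite /= redot_unitary // redot_e0.
by rewrite -conj_off.
Qed.

Lemma off_e0E : off e0 = \matrix_(i, j)
  nth 0 (nth [::] [:: [:: 0; 1; 0]; [:: -1; 0; 0]; [:: 0; 0; 0]] i) j :> 'M[C]_(1 + 2).
Proof.
apply/matrixP => i j; rewrite /off !mxE.
case: split_ordP => i' ->; rewrite mxE; case: split_ordP => j' ->; rewrite ?ord1 !mxE //=.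
- by case: j' => -[|[|//]] ?.
- by case: i' => -[|[|//]] ?; rewrite /= ?conjC1 ?conjC0 ?oppr0.
- by case: i' j' => -[|[|//]] ? [] [|[|//]] ?.
Qed.

(** The columns of V are unit eigenvectors of off e0 for the eigenvalues i, 0, -i of
    iH0.  A diagonal phase, which commutes with iH0, corrects the determinant. *)
Lemma e0_orbit : conj_orbit (@SU R 3) (iH0 R) (off e0).
Proof.
pose r : C := ((Num.sqrt 2)^-1%:C)%C.
have rC : Num.conj r = r by rewrite conjC_real.
have rr : r * r = 2^-1.
  rewrite -rmorphM -expr2 exprVn sqr_sqrtr ?ler0n //.
  by rewrite rmorphV ?unitfE ?pnatr_eq0 //= rmorph_nat.
have ii : 'i * 'i = -1 :> C by rewrite -expr2 sqrCi.
have irC : Num.conj ('i * r) = - 'i * r by rewrite rmorphM /= conjCi rC.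
have nirC : Num.conj (- 'i * r) = 'i * r by rewrite mulNr rmorphN /= irC mulNr opprK.
pose V : 'M[C]_3 := \matrix_(i, j)
  nth 0 (nth [::] [:: [:: r; 0; r]; [:: 'i * r; 0; - 'i * r]; [:: 0; 1; 0]] i) j.
have Vu : V \is unitarymx.
  have two : r * r + r * r = 1 by rewrite rr; field.
  apply/unitarymxP/matrixP => i j; rewrite !mxE !big_ord_recl big_ord0 addr0 !mxE.
  case: i => -[|[|[|//]]] i2; case: j => -[|[|[|//]]] j2 /=;
    rewrite ?irC ?nirC ?rC ?conjC0 ?conjC1; try ring.
    by rewrite mul0r add0r two.
  have -> : 'i * r * (- 'i * r) + (0 * 0 + - 'i * r * ('i * r)) = - ('i * 'i) * (r * r + r * r).
    by ring.
  by rewrite two ii opprK mulr1.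
have xV : off e0 *m V = V *m iH0 R.
  rewrite off_e0E; apply/matrixP => i j; rewrite !mxE !big_ord_recl !big_ord0 !addr0 !mxE.
  have neg : 'i * r * 'i = - r by rewrite mulrAC ii mulN1r.
  case: i => -[|[|[|//]]] i2; case: j => -[|[|[|//]]] j2 /=;
    rewrite ?mulr1n ?mulr0n; ring: ii.
pose d := \det V.
have dd : d * Num.conj d = 1.
  by rewrite -[d in Num.conj d]det_tr -det_map_mx -det_mulmx (unitarymxP Vu) det1.
pose D : 'M[C]_3 := diag_mx (\row_j [:: Num.conj d; 1; 1]`_j).
have Du : D \is unitarymx.
  apply/unitarymxP; rewrite /D tr_diag_mx map_diag_mx mulmx_diag -diag_const_mx.
  congr diag_mx; apply/rowP => j; rewrite !mxE.
  by case: j => -[|[|[|//]]] j2 /=; rewrite ?conjC1 ?mulr1 // conjCK mulrC.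
have VDu : V *m D \is unitarymx := mul_unitarymx Vu Du.
have comm : V *m D *m iH0 R = off e0 *m (V *m D).
  by rewrite -mulmxA [D *m _]diag_mxC mulmxA -xV mulmxA.
exists (V *m D); last by rewrite comm mulmxK // unitarymx_unit.
split=> //.
by rewrite det_mulmx det_diag !big_ord_recl big_ord0 !mxE /= !mulr1.
Qed.
End Flag.

Lemma card_set2 (T : eqType) (a b : T) : a != b -> ([set a; b] #= `I_2)%card.
Proof.
move=> ab; apply/card_set_bijP; exists (fun x => (x != a) : nat); split.
- by move=> x _ /=; case: (_ != _).
- move=> x y /set_mem[->|->] /set_mem[->|->] //=; rewrite eqxx ?(eq_sym b) ab //.
- case=> [|[|//]] _ /=; first by exists a; [left|rewrite eqxx].
  by exists b; [right|rewrite eq_sym ab].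
Qed.

Lemma conj_orbit_trans (R : realType) n (y x w : 'M[R[i]]_n) (G : set 'M[R[i]]_n) :
    G `<=` @SU R n ->
  conj_orbit (@SU R n) y x -> conj_orbit G x w -> conj_orbit (@SU R n) y w.
Proof.
move=> GSU [g [gu g1] <-] [h /GSU[hu h1] <-].
have hgu : h *m g \is unitarymx := mul_unitarymx hu gu.
exists (h *m g); first by split=> //; rewrite det_mulmx h1 g1 mulr1.
by rewrite (invmx_unitary hgu) (invmx_unitary hu) (invmx_unitary gu) tCM !mulmxA.
Qed.

Theorem proposition6p9 (R : realType) :
  [/\ U_H R = [set g : 'M[R[i]]_3 | SU g /\ g *m Hmx R = Hmx R *m g],
      (exists2 x, conj_orbit (@SU R 3) (iH0 R) x & sphereL R = conj_orbit (U_H R) x)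
    & infinitesimally_tight (iH0 R) (sphereL R)].
Proof.
have orb : sphereL R `<=` conj_orbit (@SU R 3) (iH0 R).
  rewrite sphere_orbit => w; apply: conj_orbit_trans (e0_orbit R).
  by move=> g [].
split.
- exact: U_H_centralizer.
- by exists (off (e0 R)); [exact: e0_orbit|exact: sphere_orbit].
split.
  rewrite sphereLE in orb *; split=> //; first exact: submanifold_off_sphere.
  by move=> _ [b b1 <-]; exact: lagrangian_off_sphere.
rewrite sphereLE; exists 2%N; split.
  by rewrite realify_off_sphere; apply: is_SB_sphere (@offrK R 2).
move=> X Xs tX; have [b b1 ->] := fL_off (isT : (0 < 2)%N) Xs tX.
apply: card_set2; rewrite (inj_eq (@off_inj R 2)) -subr_eq0 opprK.
rewrite -mulr2n -scaler_nat scaler_eq0 pnatr_eq0 /=.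
by rewrite -redot_eq0 b1 oner_eq0.
Qed.
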